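(* There exists an absolute (numerical) constant $c>0$ such that the following holds. Let $(\omega_n)_{n\ge 0}$ be a sequence of complex numbers with $|\omega_n|=1$ for all $n\in\mathbb Z_+$, and let \[ F(z)=\sum_{n\ge 0}\omega_n\,\frac{z^n}{n!},\qquad z\in\mathbb C . \] Then either $F$ is an exponential function, that is, $F(z)=\Theta e^{\alpha z}$ for some $\Theta,\alpha\in\mathbb C$ with $|\Theta|=|\alpha|=1$, or \[ \liminf_{R\to\infty}\frac{n_F(R)}{R}\ \ge\ c . \]
   Context: $\mathbb Z_+$ denotes the non-negative integers. For an entire function $F$, $n_F(R)$ denotes the number of zeroes of $F$ in the closed disk $\{|z|\le R\}$, counted with multiplicities. *)

(* Defs.v *)
From HB Require Import structures.
From mathcomp Require Import all_boot all_order all_algebra.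
From mathcomp Require Import all_classical all_reals all_analysis.
From mathcomp Require Export complex.

Set Implicit Arguments.
Unset Strict Implicit.
Unset Printing Implicit Defensive.

Import Order.TTheory GRing.Theory Num.Theory.
Import numFieldNormedType.Exports.

Local Open Scope classical_set_scope.
Local Open Scope ring_scope.

(* [R[i]] carries its usual topology only through the alias [R[i]^o]. Its norm
   [`|z|] is the modulus seen as an element of [R[i]] (zero imaginary part). *)
Notation Cplx R := ((R[i])^o).

Section Complex.
Variable R : realType.
Implicit Types (F : Cplx R -> Cplx R) (z : Cplx R) (r : R).

(* When the series diverges, [limn] takes an arbitrary value; this never occurs
   for bounded a. *)
Definition exp_series (a : nat -> Cplx R) z : Cplx R :=
  limn (series [sequence a n * (z ^+ n / n`!%:R)]_n : nat -> Cplx R).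

(* Counterpart on [R[i]] of the library's [expR]. *)
Definition cexp z : Cplx R :=
  limn (series [sequence z ^+ n / n`!%:R]_n : nat -> Cplx R).

(* Number of consecutive vanishing complex derivatives F z, F' z, F'' z, etc.:
   0 when F z != 0, and +oo when all the derivatives of F vanish at z. *)
Definition zero_mult F z : \bar R :=
  ereal_sup [set k%:R%:E | k in
    [set k : nat | forall j : nat, (j < k)%N -> derive1n j F z = 0]].

Definition zero_count F r : \bar R :=
  \esum_(z in [set z : Cplx R | `|z| <= r%:C%C /\ F z = 0]) zero_mult F z.

End Complex.

(* Main.v *)
Require Import Defs.
From mathcomp Require Import all_boot all_order all_algebra.
From mathcomp Require Import cyclic separable cyclotomic zify ring lra.
From mathcomp Require Import all_classical all_reals all_analysis.
Import Order.TTheory GRing.Theory Num.Theory.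
Import numFieldNormedType.Exports.
Local Open Scope classical_set_scope.
Local Open Scope ring_scope.

Set Implicit Arguments.
Unset Strict Implicit.
Unset Printing Implicit Defensive.

(* Suppose F has few zeros in the disk of radius r, with r large. By Hurwitz (in the
   form of a compactness argument) so does a Taylor polynomial P of F. Dividing P by
   a Blaschke product leaves a polynomial B, zero-free for |z| < r, with |B| <= e^r on
   |z| = r and |B(0)| >= 1, so Borel-Caratheodory makes log B nearly linear on a disk of radius
   rho = r / 32000: there |P(z)| <= e^(Re(al z) + small * rho), and comparison with
   the growth of P allows |al| = 1. Hence a_n = omega_n / al^n has tiny iterated
   differences, and its Newton interpolant Q at 0, .., K, where K is about rho / 16,
   grows slowly on a disk of radius 7 K. As |a_n| = 1, Q Q^* - 1 vanishes at
   0, .., K, hence is tiny on |s| <= K, so Q has no zero there; Borel-Caratheodory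
   again makes log Q nearly linear, and
   omega_(m+2) omega_m / omega_(m+1)^2 = 1 + O(1/K). If F has few zeros for
   arbitrarily large r, then omega is a geometric progression.
   Everything is done with polynomials: Cauchy estimates are averages over roots of
   unity, and log (1 - v) enters through its truncated real part. *)

(** The lower limit gives few zeros only at some sequence of radii, with nothing known in between.
    So each radius by itself must yield, for a fixed m, a relation between three consecutive
    coefficients; its error tends to 0 along the radii, which makes the relation exact. The
    constants balance as follows. Newton interpolation on |s| <= 7 K needs 8 K <= rho / 2, whence K
    ~ rho / 16. The exponent 6 rho / 1000 left by the first half is then at most (K + 1) / 10, so Q
    Q^* is of order e^(K / 5) at most, whereas each of its K + 1 interpolation points gains a factor
    3 between the radii 7 K and K. Finally the ratio of coefficients is a second-order quantity: the
    linear term of log Q cancels in it, and log Q is O(K) on a disk of radius comparable to K, which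
    leaves O(K / K^2). *)

Local Notation Re := complex.Re.
Local Notation Im := complex.Im.
Local Notation cabs := Normc.normc.

(** * The modulus as a real number, and real and imaginary parts *)

Section Modulus.
Variable R : realType.
Implicit Types (z w : R[i]) (r : R).

Lemma normE z : `|z| = (cabs z)%:C%C.
Proof. by rewrite normc_def; case: z. Qed.

Lemma cabs_ge0 z : 0 <= cabs z.
Proof. by case: z => a b; apply: sqrtr_ge0. Qed.

Lemma cabs0 : cabs (0 : R[i]) = 0. Proof. exact: Normc.normc0. Qed.
Lemma cabs1 : cabs (1 : R[i]) = 1. Proof. exact: Normc.normc1. Qed.
Lemma cabsM z w : cabs (z * w) = cabs z * cabs w. Proof. exact: Normc.normcM. Qed.
Lemma cabsV z : cabs z^-1 = (cabs z)^-1. Proof. exact: Normc.normcV. Qed.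
Lemma cabsN z : cabs (- z) = cabs z. Proof. exact: normcN. Qed.
Lemma cabsD z w : cabs (z + w) <= cabs z + cabs w. Proof. exact: le_normcD. Qed.
Lemma cabsB z w : cabs (z - w) <= cabs z + cabs w.
Proof. by rewrite -(cabsN w); apply: cabsD. Qed.
Lemma cabsB_ge z w : cabs z - cabs w <= cabs (z - w).
Proof. by rewrite lerBlDr; apply: le_trans (cabsD _ _); rewrite subrK. Qed.

Lemma cabs_eq0 z : (cabs z == 0) = (z == 0).
Proof.
by apply/eqP/eqP => [/Normc.eq0_normc //|->]; rewrite cabs0.
Qed.

Lemma cabs_gt0 z : (0 < cabs z) = (z != 0).
Proof. by rewrite lt_def cabs_ge0 cabs_eq0 andbT. Qed.

Lemma cabsX z n : cabs (z ^+ n) = cabs z ^+ n.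
Proof. by elim: n => [|n IH]; rewrite ?cabs1 // !exprS cabsM IH. Qed.

Lemma cabs_prod (I : Type) (s : seq I) (P : pred I) (F : I -> R[i]) :
  cabs (\prod_(i <- s | P i) F i) = \prod_(i <- s | P i) cabs (F i).
Proof. by elim/big_rec2: _ => [|i y1 y2 _ <-]; rewrite ?cabs1 ?cabsM. Qed.

Lemma cabs_sum (I : Type) (s : seq I) (P : pred I) (F : I -> R[i]) :
  cabs (\sum_(i <- s | P i) F i) <= \sum_(i <- s | P i) cabs (F i).
Proof.
elim/big_rec2: _ => [|i y1 y2 _ H]; first by rewrite cabs0.
by apply: le_trans (cabsD _ _) _; rewrite lerD2l.
Qed.

Lemma cabs_real r : cabs r%:C%C = `|r|.
Proof. by rewrite /= expr0n /= addr0 sqrtr_sqr. Qed.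

Lemma cabs_nat n : cabs (n%:R : R[i]) = n%:R.
Proof. by rewrite -(rmorph_nat (real_complex R)) cabs_real ger0_norm. Qed.

Lemma cabs_conj z : cabs z^*%C = cabs z.
Proof. by case: z => a b; rewrite /= sqrrN. Qed.

Lemma sqr_cabs z : cabs z ^+ 2 = Re z ^+ 2 + Im z ^+ 2.
Proof. by case: z => a b /=; rewrite sqr_sqrtr // addr_ge0 ?sqr_ge0. Qed.

Lemma mulJc z : z * z^*%C = (cabs z ^+ 2)%:C%C.
Proof. by rewrite sqr_cabs; case: z => a b /=; simpc; congr (_ +i* _)%C; ring. Qed.

Lemma Re_le_cabs z : `|Re z| <= cabs z.
Proof.
rewrite -[leLHS]ger0_norm // -ler_sqr ?nnegrE ?cabs_ge0 // normr_id.
by rewrite real_normK ?num_real // sqr_cabs lerDl sqr_ge0.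
Qed.

Lemma Im_le_cabs z : `|Im z| <= cabs z.
Proof.
rewrite -[leLHS]ger0_norm // -ler_sqr ?nnegrE ?cabs_ge0 // normr_id.
by rewrite real_normK ?num_real // sqr_cabs lerDr sqr_ge0.
Qed.

Lemma cabs_le_ReIm z : cabs z <= `|Re z| + `|Im z|.
Proof.
rewrite -ler_sqr ?nnegrE ?cabs_ge0 ?addr_ge0 // sqr_cabs sqrrD.
by rewrite !real_normK ?num_real // addrAC lerDl mulrn_wge0 ?mulr_ge0.
Qed.

Lemma ReD z w : Re (z + w) = Re z + Re w. Proof. by case: z w => a b [c d]. Qed.
Lemma ImD z w : Im (z + w) = Im z + Im w. Proof. by case: z w => a b [c d]. Qed.
Lemma ReN z : Re (- z) = - Re z. Proof. by case: z. Qed.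
Lemma ReZ r z : Re (r%:C%C * z) = r * Re z.
Proof. by case: z => a b /=; rewrite mul0r subr0. Qed.

Lemma Re_sum (I : Type) (s : seq I) (P : pred I) (F : I -> R[i]) :
  Re (\sum_(i <- s | P i) F i) = \sum_(i <- s | P i) Re (F i).
Proof. by apply: (big_morph _ ReD). Qed.
Lemma Im_sum (I : Type) (s : seq I) (P : pred I) (F : I -> R[i]) :
  Im (\sum_(i <- s | P i) F i) = \sum_(i <- s | P i) Im (F i).
Proof. by apply: (big_morph _ ImD). Qed.

End Modulus.

(** * Roots of unity and discrete orthogonality *)

Section UnityRoots.
Variable R : realType.
Local Notation C := R[i].

Lemma prim_root_exists n : (0 < n)%N -> {z : C | n.-primitive_root z}.
Proof.
move=> n0; apply/sigW.
have [rs] := closed_field_poly_normal ('X^n - 1 : {poly C}).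
rewrite lead_coefDl; last by rewrite size_polyN size_poly1 size_polyXn.
rewrite lead_coefXn scale1r => Ers.
have sz : size rs = n.
  have: size ('X^n - 1 : {poly C}) = n.+1 by rewrite size_XnsubC.
  by rewrite Ers size_prod_XsubC => -[].
have urs : uniq rs.
  rewrite -separable_prod_XsubC -Ers.
  by apply: separable_Xn_sub_1; rewrite pnatr_eq0 -lt0n.
have ars : all n.-unity_root rs.
  by apply/allP => z; rewrite -root_prod_XsubC -Ers.
have /hasP[z _ zP] := has_prim_root n0 ars urs (eq_leq (esym sz)).
by exists z.
Qed.

Variables (D : nat) (zeta : C).
Hypothesis zP : D.-primitive_root zeta.

Lemma cabs_prim : cabs zeta = 1.
Proof.
have D0 := prim_order_gt0 zP.
have : cabs zeta ^+ D = 1 by rewrite -cabsX (prim_expr_order zP) cabs1.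
by move/eqP; rewrite pexpr_eq1 ?cabs_ge0 // => /eqP.
Qed.

Lemma sum_prim l : \sum_(k < D) zeta ^+ (k * l) = if (D %| l)%N then D%:R else 0.
Proof.
under eq_bigr do rewrite mulnC exprM.
case: ifP => Dl.
  have -> : zeta ^+ l = 1 by apply/eqP; rewrite -(prim_order_dvd zP).
  by under eq_bigr do rewrite expr1n; rewrite sumr_const card_ord.
have z1 : zeta ^+ l != 1 by rewrite -(prim_order_dvd zP) Dl.
have := subrX1 (zeta ^+ l) D.
rewrite -exprM mulnC exprM (prim_expr_order zP) expr1n subrr.
by move/esym/eqP; rewrite mulf_eq0 subr_eq0 (negbTE z1) => /eqP.
Qed.

(** Discrete Fourier inversion. The exponent [D - m] stands for -m, which keeps it in [nat]; as
    [size f <= D], no other index involved is congruent to [m]. *)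
Lemma sum_prim_horner (f : {poly C}) (r : R) (m : nat) :
    (size f <= D)%N -> (m < D)%N ->
  \sum_(k < D) f.[r%:C%C * zeta ^+ k] * zeta ^+ (k * (D - m))
    = D%:R * f`_m * r%:C%C ^+ m.
Proof.
move=> sf mD.
transitivity (\sum_(k < D) \sum_(l < D)
   (f`_l * r%:C%C ^+ l) * zeta ^+ (k * (l + (D - m)))).
  apply: eq_bigr => k _; rewrite (horner_coef_wide _ sf) mulr_suml.
  apply: eq_bigr => l _; rewrite exprMn -exprM mulnDr exprD; ring.
rewrite exchange_big /= (bigD1 (Ordinal mD)) //= [X in _ + X]big1 ?addr0.
  by rewrite -mulr_sumr sum_prim subnKC ?dvdnn; [ring|exact: ltnW].
move=> l lm; rewrite -mulr_sumr sum_prim; case: ifP => //; last by rewrite mulr0.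
move=> /dvdnP[q E]; exfalso; move/eqP: lm; apply; apply/val_inj => /=.
have lD := ltn_ord l.
(* This multiple of [D] lies strictly between 0 and 2 D. *)
have /eqP : (l + (D - m) = D)%N.
  have: (0 < l + (D - m) < D + D)%N.
    rewrite addn_gt0 subn_gt0 mD orbT /= -addSn.
    by rewrite leq_add ?leq_subr.
  rewrite E -[X in (_ < X + X)%N]mul1n addnn -muln2 -mulnA mul1n.
  case: q {E} => [|[|q]]; rewrite ?mul0n ?mul1n //.
  by move=> /andP[_]; rewrite mulnC ltn_pmul2l ?(prim_order_gt0 zP).
by rewrite addnBA ?(ltnW mD) // -(eqn_add2r m) subnK ?(leq_trans (ltnW mD)) ?leq_addl // addnC eqn_add2l => /eqP.
Qed.

End UnityRoots.

(** * Cauchy and Borel-Caratheodory estimates for polynomials *)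

Section Cauchy.
Variable R : realType.
Local Notation C := R[i].
Implicit Types (f : {poly C}) (r M : R) (z w : C).

Lemma cauchy_coef f r M m : 0 <= r ->
    (forall z, cabs z = r -> cabs f.[z] <= M) -> cabs f`_m * r ^+ m <= M.
Proof.
move=> r0 H.
have M0 : 0 <= M by apply: le_trans (H r%:C%C _); rewrite ?cabs_ge0 // cabs_real ger0_norm.
pose D := (size f + m).+1.
have [zeta zP] := @prim_root_exists R D isT.
have := sum_prim_horner zP r (m := m) (leqW (leq_addr _ _)).
rewrite /D ltnS leq_addl => /(_ isT) /(congr1 (@Normc.normc R)).
rewrite !cabsM cabs_nat cabsX cabs_real (ger0_norm r0) => E.
have : D%:R * (cabs f`_m * r ^+ m) <= D%:R * M.
  rewrite mulrA -E; apply: le_trans (cabs_sum _ _ _) _.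
  rewrite -[D in leRHS]card_ord -sumr_const mulr_suml; apply: ler_sum => k _.
  rewrite mul1r cabsM cabsX (cabs_prim zP) expr1n mulr1; apply: H.
  by rewrite cabsM cabs_real ger0_norm // cabsX (cabs_prim zP) expr1n mulr1.
by rewrite ler_pM2l // ltr0n.
Qed.

Lemma sum_half_le n : \sum_(i < n) (2^-1 : R) ^+ i <= 2.
Proof.
have -> : \sum_(i < n) (2^-1 : R) ^+ i = 2 - 2 * 2^-1 ^+ n.
  elim: n => [|n IH]; first by rewrite big_ord0 expr0; ring.
  by rewrite big_ord_recr IH /= exprS; field.
by rewrite gerBl mulr_ge0 ?exprn_ge0.
Qed.

(** Stands in for the maximum principle at the price of a factor 2: on half the radius the
    coefficient bounds sum to a geometric series of ratio 1/2. *)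
Lemma cauchy_half f r M z : 0 <= r ->
    (forall w, cabs w = r -> cabs f.[w] <= M) ->
  cabs z <= r / 2 -> cabs f.[z] <= 2 * M.
Proof.
move=> r0 H zr.
have M0 : 0 <= M by apply: le_trans (H r%:C%C _); rewrite ?cabs_ge0 // cabs_real ger0_norm.
rewrite horner_coef; apply: le_trans (cabs_sum _ _ _) _.
apply: le_trans (_ : \sum_(i < size f) (2^-1 ^+ i) * M <= _).
  apply: ler_sum => i _; rewrite cabsM cabsX.
  apply: le_trans (_ : cabs f`_i * (r / 2) ^+ i <= _).
    by rewrite ler_wpM2l ?cabs_ge0 // lerXn2r ?nnegrE ?cabs_ge0 // divr_ge0.
  rewrite exprMn mulrA mulrC ler_wpM2l ?exprn_ge0 //; first exact: cauchy_coef.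
by rewrite -mulr_suml ler_wpM2r // sum_half_le.
Qed.

(* Testing the nonnegative function [M - Re T] against a root of unity kills the
   constant [M] and, up to conjugation, isolates one coefficient of [T]. *)
Lemma borel_caratheodory_poly (T : {poly C}) r M m : 0 <= r -> (0 < m)%N ->
    T`_0 = 0 -> (forall z, cabs z = r -> Re T.[z] <= M) ->
  cabs T`_m * r ^+ m <= 2 * M.
Proof.
move=> r0 m0 T0 H.
pose D := (size T + m).+1.
have [zeta zP] := @prim_root_exists R D isT.
have sT : (size T <= D)%N by rewrite leqW ?leq_addr.
have mD : (m < D)%N by rewrite /D ltnS leq_addl.
have E1 := sum_prim_horner zP r sT mD.
have E0 := sum_prim_horner zP r sT (ltn0Sn _).
(* The conjugate has frequencies -l, which meet [m] only if [D] divides l + m. The size of [D]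
   excludes this for 0 < l < size T, and [T0] deals with l = 0. *)
have EC : \sum_(k < D) (T.[r%:C%C * zeta ^+ k])^*%C * zeta ^+ (k * (D - m)) = 0.
  have zJ : zeta^*%C = zeta^-1.
    apply/(@mulfI _ zeta); first by rewrite -cabs_gt0 (cabs_prim zP).
    by rewrite mulJc (cabs_prim zP) expr1n divff // -cabs_gt0 (cabs_prim zP).
  transitivity (\sum_(k < D) \sum_(l < D)
     ((T`_l)^*%C * r%:C%C ^+ l) * zeta ^+ (k * (D - l + (D - m)))).
    apply: eq_bigr => k _; rewrite (horner_coef_wide _ sT) rmorph_sum mulr_suml.
    apply: eq_bigr => l _.
    rewrite rmorphM rmorphXn rmorphM rmorphXn /= zJ oppr0 -/(real_complex _ r).
    rewrite exprMn exprVn exprVn -!mulrA; congr (_ * (_ * _)).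
    rewrite mulnDr exprD; congr (_ * _).
    have zn0 : zeta ^+ k ^+ l != 0 by rewrite !expf_neq0 // -cabs_gt0 (cabs_prim zP).
    apply: (mulfI zn0); rewrite divff // -exprM -exprD -mulnDr subnKC ?(ltnW (ltn_ord l)) //.
    by rewrite mulnC exprM (prim_expr_order zP) expr1n.
  rewrite exchange_big big1 //= => l _; rewrite -mulr_sumr sum_prim //.
  case: ifP => [/dvdnP[q E]|_]; last by rewrite mulr0.
  have lD := ltn_ord l; have [l0|l0] := posnP l.
    by rewrite l0 T0 conjc0 !mul0r.
  have [q1|] := leqP q 1; last first.
    move=> q2; have: (q * D < 2 * D)%N by rewrite -E mul2n -addnn -addnS leq_add ?leq_subr // ltn_subrL m0.
    by rewrite ltn_pmul2r // ltnNge q2.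
  have [lT|lT] := ltnP l (size T); last by rewrite nth_default // conjc0 !mul0r.
  have: (D < q * D)%N by rewrite -E; have eD : D = (size T + m).+1 by []; clearbody D; lia.
  by rewrite -[ltnLHS]mul1n ltn_pmul2r // ltnNge q1.
pose g k : R := M - Re T.[r%:C%C * zeta ^+ k].
have circ k : cabs (r%:C%C * zeta ^+ k) = r.
  by rewrite cabsM cabs_real ger0_norm // cabsX (cabs_prim zP) expr1n mulr1.
have g0 k : 0 <= g k by rewrite subr_ge0 H.
have Eg : \sum_(k < D) g k = D%:R * M.
  rewrite sumrB sumr_const card_ord -[RHS]subr0 mulr_natl; congr (_ - _).
  rewrite -Re_sum; move: E0; rewrite T0 mulr0 mul0r subn0.
  under eq_bigr do rewrite mulnC exprM (prim_expr_order zP) expr1n mulr1.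
  by move=> ->.
have Es : \sum_(k < D) (g k)%:C%C * zeta ^+ (k * (D - m)) = - (D%:R * T`_m * r%:C%C ^+ m / 2).
  transitivity (\sum_(k < D) (M%:C%C * zeta ^+ (k * (D - m))
     - (T.[r%:C%C * zeta ^+ k] * zeta ^+ (k * (D - m))) / 2
     - ((T.[r%:C%C * zeta ^+ k])^*%C * zeta ^+ (k * (D - m))) / 2)).
    by apply: eq_bigr => k _; rewrite /g rmorphB /= ReJ_add; field; rewrite ?pnatr_eq0.
  rewrite !sumrB -!mulr_suml E1 EC mul0r subr0 -mulr_sumr sum_prim //.
  case: ifP => [/dvdn_leq|_]; last by rewrite mulr0 sub0r.
  by rewrite subn_gt0 mD => /(_ isT); rewrite leqNgt ltn_subrL m0.
have := congr1 (@Normc.normc R) Es.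
rewrite cabsN !cabsM cabs_nat cabsX cabs_real (ger0_norm r0) cabsV cabs_nat => {}Es.
have : D%:R * (cabs T`_m * r ^+ m) / 2 <= D%:R * M.
  rewrite mulrA; rewrite -Es -Eg; apply: le_trans (cabs_sum _ _ _) _.
  apply: ler_sum => k _; rewrite cabsM cabsX (cabs_prim zP) expr1n mulr1.
  by rewrite cabs_real ger0_norm.
by rewrite -mulrA ler_pM2l ?ltr0n // ler_pdivrMr // [leRHS]mulrC.
Qed.

End Cauchy.

(** * Truncated logarithms, power sums and Newton's identities *)

Section LogSeries.
Variable R : realType.
Local Notation C := R[i].
Implicit Types (v z : C) (r M : R).

Lemma sqr_cabs_1B v (t : R) :
  cabs (1 - t%:C%C * v) ^+ 2 = 1 - 2 * t * Re v + t ^+ 2 * cabs v ^+ 2.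
Proof. by rewrite !sqr_cabs; case: v => a b /=; ring. Qed.

Lemma Re_div_1B v (t : R) : 1 - t%:C%C * v != 0 ->
  Re (v / (1 - t%:C%C * v)) =
    (Re v - t * cabs v ^+ 2) / cabs (1 - t%:C%C * v) ^+ 2.
Proof.
rewrite -cabs_gt0 => w0.
have : cabs (1 - t%:C%C * v) ^+ 2 != 0 by rewrite sqrf_eq0 gt_eqF.
rewrite !sqr_cabs; case: v {w0} => a b /= H; field.
by move: H; congr (_ != 0); ring.
Qed.

(** Remainder of Re log (1 - v), by the mean value theorem along the segment from 0 to v: ln |1 - t
    v| is half the logarithm of a real quadratic in t, so no branch of the complex logarithm is
    involved. *)
Lemma ln_cabs_1B v n : cabs v < 1 ->
  `|ln (cabs (1 - v)) + Re (\sum_(m < n) v ^+ m.+1 / m.+1%:R)|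
    <= cabs v ^+ n.+1 / (1 - cabs v).
Proof.
move=> v1.
pose p : {poly R} := 1%:P - (2 * Re v) *: 'X + (cabs v ^+ 2) *: 'X^2.
pose q : {poly R} := \sum_(m < n) (Re (v ^+ m.+1) / m.+1%:R) *: 'X^(m.+1).
pose phi (t : R) := 2^-1 * ln p.[t] + q.[t].
have pE t : p.[t] = cabs (1 - t%:C%C * v) ^+ 2.
  by rewrite sqr_cabs_1B !(hornerD, hornerN, hornerZ, hornerX, hornerXn, hornerC); ring.
have w_ge (t : R) : 0 <= t <= 1 -> 1 - cabs v <= cabs (1 - t%:C%C * v).
  move=> /andP[t0 t1].
  apply: le_trans (cabsB_ge _ _); rewrite cabs1 lerD2l lerN2 cabsM cabs_real.
  by rewrite ger0_norm // ler_piMl ?cabs_ge0.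
have w_gt (t : R) : 0 <= t <= 1 -> 0 < cabs (1 - t%:C%C * v).
  by move=> tI; apply: lt_le_trans (w_ge _ tI); rewrite subr_gt0.
(* The truncated geometric series cancels all of the derivative but its tail. *)
pose dphi (t : R) := - Re (v * (t%:C%C * v) ^+ n / (1 - t%:C%C * v)).
have dphiE (t : R) : 0 <= t <= 1 -> is_derive t 1 phi (dphi t).
  move=> tI; have p0 : 0 < p.[t] by rewrite pE exprn_gt0 // w_gt.
  have dl : is_derive t 1 (@ln R \o horner p) ((p.[t])^-1 * p^`().[t]).
    have dl := is_derive1_ln p0.
    exact: is_derive1_comp.
  have -> : phi = (2^-1 \*: (@ln R \o horner p)) + horner q by apply/funext.
  apply: is_derive_eq; rewrite /dphi.
  have w0 : 1 - t%:C%C * v != 0 by rewrite -cabs_gt0 w_gt.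
  have -> : v * (t%:C%C * v) ^+ n / (1 - t%:C%C * v) =
     v / (1 - t%:C%C * v) - \sum_(m < n) (t ^+ m)%:C%C * v ^+ m.+1.
    have -> : \sum_(m < n) (t ^+ m)%:C%C * v ^+ m.+1 =
              v * \sum_(m < n) (t%:C%C * v) ^+ m.
      rewrite mulr_sumr; apply: eq_bigr => m _.
      by rewrite exprMn rmorphXn exprS /=; ring.
    have := subrX1 (t%:C%C * v) n; move: (\sum_(_ < n) _) => S HS.
    apply: (mulIf w0); rewrite mulrBl !divfK // -mulrA.
    have -> : S * (1 - t%:C%C * v) = 1 - (t%:C%C * v) ^+ n.
      by rewrite -[RHS]opprB HS; ring.
    by ring.
  rewrite ReD ReN Re_div_1B // Re_sum opprB -pE addrC; congr (_ + _).
    rewrite raddf_sum horner_sum; apply: eq_bigr => m _ /=.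
    rewrite derivZ derivXn /= hornerZ hornerMn hornerXn ReZ -[_ *+ _]mulr_natr.
    by field; rewrite nat1r pnatr_eq0.
  have -> : p^`().[t] = - (2 * Re v) + cabs v ^+ 2 * (2 * t).
    rewrite derivD derivB derivC !derivZ derivX derivXn /=.
    by rewrite !(hornerD, hornerN, hornerZ, hornerC, hornerMn, hornerX) mulr2n; ring.
  have -> (x y : R) : x *: y = x * y by [].
  by field; rewrite gt_eqF.
have [||c] := @MVT_segment _ phi dphi 0 1 ler01.
- by move=> x; rewrite in_itv /= => /andP[/ltW x0 /ltW x1]; apply: dphiE; rewrite x0.
- apply: derivable_within_continuous => x; rewrite in_itv /= => xI.
  by apply: ex_derive; apply: dphiE.
rewrite in_itv /= => cI.
have -> : phi 1 = ln (cabs (1 - v)) + Re (\sum_(m < n) v ^+ m.+1 / m.+1%:R).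
  rewrite /phi pE mul1r lnXn; last by have := w_gt 1; rewrite mul1r lexx ler01 => ->.
  have -> (x : R) : 2^-1 * (x *+ 2) = x by rewrite -mulr_natr; field.
  rewrite horner_sum Re_sum; congr (_ + _).
  apply: eq_bigr => m _; rewrite hornerZ hornerXn expr1n mulr1 mulrC -ReZ.
  by rewrite fmorphV rmorph_nat mulrC.
have -> : phi 0 = 0.
  rewrite /phi pE mul0r subr0 cabs1 expr1n ln1 mulr0 add0r horner_sum big1 // => m _.
  by rewrite hornerZ hornerXn expr0n mulr0.
rewrite !subr0 mulr1 => ->; rewrite normrN; apply: le_trans (Re_le_cabs _) _.
have /andP[c0 c1] := cI.
rewrite cabsM cabsV !cabsM cabsX exprS.
apply: ler_pM; rewrite ?mulr_ge0 ?exprn_ge0 ?cabs_ge0 ?invr_ge0 ?cabs_ge0 //.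
  rewrite ler_wpM2l ?cabs_ge0 // lerXn2r ?nnegrE ?cabs_ge0 // cabsM cabs_real.
  by rewrite ger0_norm // ler_piMl ?cabs_ge0.
by rewrite lef_pV2 ?posrE ?w_gt ?subr_gt0 // w_ge.
Qed.

(** With [vs] the inverse roots, log [rprod vs] has Taylor coefficients - [psum vs m] / m. *)
Definition psum (vs : seq C) m : C := \sum_(v <- vs) v ^+ m.
Definition rprod (vs : seq C) z : C := \prod_(v <- vs) (1 - v * z).

Lemma rprod_neq0 vs z : (forall v, v \in vs -> cabs v * cabs z < 1) ->
  rprod vs z != 0.
Proof.
move=> H; rewrite prodf_seq_neq0; apply/allP => v /H; rewrite -cabsM => vz.
by apply/implyP => _; rewrite subr_eq0; apply/eqP => E; rewrite -E cabs1 ltxx in vz.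
Qed.

Lemma ln_rprod vs z n : (forall v, v \in vs -> cabs v * cabs z <= 2^-1) ->
  `|ln (cabs (rprod vs z)) + Re (\sum_(m < n) psum vs m.+1 * z ^+ m.+1 / m.+1%:R)|
    <= (size vs)%:R / 2 ^+ n.
Proof.
move=> H.
have -> : ln (cabs (rprod vs z)) = \sum_(v <- vs) ln (cabs (1 - v * z)).
  elim: vs H => [|v vs IH] H; first by rewrite /rprod !big_nil cabs1 ln1.
  have H' w : w \in vs -> cabs w * cabs z <= 2^-1 by move=> ?; apply: H; rewrite inE orbC;
    apply/orP; left.
  have l w : w \in v :: vs -> cabs w * cabs z < 1.
    by move=> /H /le_lt_trans; apply; rewrite invf_lt1 ?ltr1n.
  rewrite /rprod !big_cons cabsM lnM ?posrE ?cabs_gt0 ?IH //.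
    by have := @rprod_neq0 [:: v] z; rewrite /rprod big_seq1; apply => w;
      rewrite inE => /eqP ->; apply: l; rewrite inE eqxx.
  by apply: rprod_neq0 => w wv; apply: l; rewrite inE wv orbT.
have -> : Re (\sum_(m < n) psum vs m.+1 * z ^+ m.+1 / m.+1%:R) =
    \sum_(v <- vs) Re (\sum_(m < n) (v * z) ^+ m.+1 / m.+1%:R).
  rewrite -Re_sum exchange_big; congr Re; apply: eq_bigr => m _ /=.
  by rewrite /psum !mulr_suml; apply: eq_bigr => v _; rewrite exprMn.
rewrite -big_split /=; apply: le_trans (ler_norm_sum _ _ _) _.
apply: le_trans (_ : \sum_(v <- vs) (2 ^+ n)^-1 <= _); last first.
  by rewrite big_const_seq count_predT iter_addr_0 mulr_natl.
rewrite big_seq [leRHS]big_seq; apply: ler_sum => v /H; rewrite -cabsM => vz.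
have vz1 : cabs (v * z) < 1 by apply: le_lt_trans vz _; rewrite invf_lt1 ?ltr1n.
apply: le_trans (ln_cabs_1B _ vz1) _.
rewrite ler_pdivrMr ?subr_gt0 //.
apply: le_trans (_ : 2^-1 ^+ n.+1 <= _).
  by rewrite lerXn2r ?nnegrE ?cabs_ge0.
rewrite exprSr exprVn ler_wpM2l ?invr_ge0 ?exprn_ge0 //; lra.
Qed.

(** Lets the truncation order go to infinity, so that the number of factors in [ln_rprod] disappears
    from the later bounds. *)
Lemma le_limit_half (x y K : R) n0 :
  (forall n, (n0 <= n)%N -> x <= y + K / 2 ^+ n) -> x <= y.
Proof.
move=> H; apply/ler_addgt0Pr => e e0.
pose n := (n0 + Num.bound (K / e))%N.
apply: le_trans (H n (leq_addr _ _)) _; rewrite lerD2l ler_pdivrMr ?exprn_gt0 //.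
by rewrite mulrC -ler_pdivrMr // ltW // upper_nthrootP // leq_addl.
Qed.

(** Borel-Caratheodory for the truncated logarithm: an upper bound on ln |rprod| alone controls
    every Taylor coefficient, whatever the number of factors. *)
Lemma psum_bound vs r M m : 0 < r -> (0 < m)%N ->
    (forall v, v \in vs -> cabs v * r <= 2^-1) ->
    (forall z, cabs z = r -> cabs (rprod vs z) <= expR M) ->
  cabs (psum vs m) * r ^+ m <= 2 * M * m%:R.
Proof.
move=> r0 m0 Hv HE; apply: (@le_limit_half _ _ (2 * (size vs)%:R * m%:R) m) => n mn.
(* The constant coefficient is a division by zero, hence 0, as Borel-Caratheodory requires. *)
pose T : {poly C} := \poly_(i < n.+1) (- psum vs i / i%:R).
have T0 : T`_0 = 0 by rewrite coef_poly /= invr0 mulr0.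
have H z : cabs z = r -> Re T.[z] <= M + (size vs)%:R / 2 ^+ n.
  move=> zr; rewrite horner_poly big_ord_recl /= invr0 mulr0 mul0r add0r.
  have -> : Re (\sum_(i < n) - psum vs (bump 0 i) / (bump 0 i)%:R * z ^+ bump 0 i) =
     - Re (\sum_(i < n) psum vs i.+1 * z ^+ i.+1 / i.+1%:R).
    rewrite -ReN -sumrN; congr Re; apply: eq_bigr => i _; rewrite /bump leq0n add1n; ring.
  have hv : forall v, v \in vs -> cabs v * cabs z <= 2^-1 by rewrite zr.
  have := ln_rprod n hv; rewrite ler_norml => /andP[+ _].
  have nz : rprod vs z != 0.
    by apply: rprod_neq0 => v /hv /le_lt_trans; apply; rewrite invf_lt1 ?ltr1n.
  have : ln (cabs (rprod vs z)) <= M.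
    by rewrite -ler_expR lnK ?posrE ?cabs_gt0 // HE.
  by move: (Re _) (ln _) (_ / _) => a b c; lra.
have := borel_caratheodory_poly (ltW r0) m0 T0 H.
rewrite coef_poly ltnS mn cabsM cabsN cabsV cabs_nat mulrAC ler_pdivrMr ?ltr0n //.
by move=> /le_trans; apply; rewrite le_eqVlt; apply/orP; left; apply/eqP; ring.
Qed.

(** By [psum_bound] the terms of degree i >= 2 are at most 2 M d^i, and these sum to at most 4 M d^2
    since d <= 1/2. *)
Lemma ln_rprod_linear vs r M z (d : R) : 0 < r -> 0 <= M -> 0 <= d -> d <= 2^-1 ->
    (forall v, v \in vs -> cabs v * r <= 2^-1) ->
    (forall z, cabs z = r -> cabs (rprod vs z) <= expR M) ->
    cabs z <= d * r ->
  `|ln (cabs (rprod vs z)) + Re (psum vs 1 * z)| <= 4 * M * d ^+ 2.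
Proof.
move=> r0 M0 d0 d2 Hv HE zd.
apply: (@le_limit_half _ _ (size vs)%:R 1) => -[//|n] _.
have hv v : v \in vs -> cabs v * cabs z <= 2^-1.
  move=> vv; apply: le_trans (Hv _ vv); rewrite ler_wpM2l ?cabs_ge0 //.
  apply: le_trans zd _; rewrite ler_piMl ?(ltW r0) //; apply: le_trans d2 _.
  by rewrite invf_le1 ?ler1n.
have := ln_rprod n.+1 hv; rewrite big_ord_recl divr1 expr1 ReD.
set A := ln _; set B := Re (psum _ _ * _); set S := Re (\sum_(i < n) _).
have HS : `|S| <= 4 * M * d ^+ 2.
  apply: le_trans (Re_le_cabs _) _; apply: le_trans (cabs_sum _ _ _) _.
  apply: le_trans (_ : \sum_(i < n) (2 * M * d ^+ 2) * 2^-1 ^+ i <= _).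
    apply: ler_sum => i _; rewrite lift0 2!cabsM cabsX cabsV cabs_nat.
    have := psum_bound (m := i.+2) r0 isT Hv HE.
    rewrite ler_pdivrMr ?ltr0n // => Hp.
    apply: le_trans (_ : cabs (psum vs i.+2) * (d * r) ^+ i.+2 <= _).
      by rewrite ler_wpM2l ?cabs_ge0 // lerXn2r ?nnegrE ?cabs_ge0 // mulr_ge0 // ltW.
    rewrite exprMn mulrCA mulrC; apply: le_trans (_ : 2 * M * i.+2%:R * d ^+ i.+2 <= _).
      by rewrite ler_wpM2r // exprn_ge0.
    rewrite -(addn2 i) exprD [X in _ <= X](_ : _ =
      2 * M * (i + 2)%:R * (2^-1 ^+ i * d ^+ 2)); last by ring.
    rewrite ler_wpM2l ?mulr_ge0 // ler_wpM2r ?exprn_ge0 // lerXn2r ?nnegrE //.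
  rewrite -mulr_sumr [leRHS](_ : _ = 2 * M * d ^+ 2 * 2); last by ring.
  by rewrite ler_wpM2l ?sum_half_le // !mulr_ge0 // exprn_ge0.
move: HS; rewrite !ler_norml; move: A B S (_ / _) (4 * M * d ^+ 2) => A B S c e.
lra.
Qed.

(** For E = prod (1 - u X) this compares coefficients in X E' = - E sum (u X / (1 - u X)); induction
    on the factors keeps the argument within polynomials. *)
Lemma newton_identities (us : seq C) n :
  (\prod_(u <- us) (1 - u *: 'X))`_n *+ n
    = - \sum_(m < n) psum us m.+1 * (\prod_(u <- us) (1 - u *: 'X))`_(n - m.+1).
Proof.
elim: us n => [|u us IH] n.
  rewrite big_nil coef1 big1 => [|m _]; last by rewrite /psum big_nil mul0r.
  by case: n => [|n] /=; rewrite ?mulr0n ?mul0rn oppr0.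
rewrite big_cons; set E := \prod_(_ <- us) _ in IH *.
have cE k : ((1 - u *: 'X) * E)`_k = E`_k - (if k is k'.+1 then u * E`_k' else 0).
  by rewrite mulrBl mul1r coefB -scalerAl coefZ coefXM; case: k => [|k] //=; rewrite mulr0.
case: n => [|n]; first by rewrite big_ord0 oppr0 mulr0n.
rewrite cE mulrnBl IH.
have pE m : psum (u :: us) m = u ^+ m + psum us m by rewrite /psum big_cons.
under [in RHS]eq_bigr => m _ do rewrite pE mulrDl.
rewrite big_split /=.
(* Telescopes: the terms are g i - g (i + 1), except the last, whose second half would involve a
   coefficient of index -1. *)
have -> : \sum_(i < n.+1) u ^+ i.+1 * ((1 - u *: 'X) * E)`_(n.+1 - i.+1) = u * E`_n.
  pose g k := u ^+ k.+1 * E`_(n - k).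
  transitivity (\sum_(i < n.+1) (g i - (if i == n :> nat then 0 else g i.+1))).
    apply: eq_bigr => i _; rewrite subSS cE mulrBr /g; congr (_ - _).
    case: eqP => [->|/eqP ni]; first by rewrite subnn mulr0.
    have iltn : (i < n)%N by rewrite ltn_neqAle ni -ltnS ltn_ord.
    by rewrite -(subnSK iltn) mulrA -exprSr.
  rewrite sumrB big_ord_recl /= -addrA [X in _ + X](_ : _ = 0) ?addr0;
    first by rewrite /g expr1 subn0.
  rewrite [X in _ - X]big_ord_recr /= eqxx addr0; apply/eqP; rewrite subr_eq0; apply/eqP.
  by apply: eq_bigr => i _; rewrite ltn_eqF.
have -> : \sum_(i < n.+1) psum us i.+1 * ((1 - u *: 'X) * E)`_(n.+1 - i.+1) =
   \sum_(i < n.+1) psum us i.+1 * E`_(n.+1 - i.+1)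
     - u * \sum_(i < n) psum us i.+1 * E`_(n - i.+1).
  under eq_bigr => i _ do rewrite cE mulrBr.
  rewrite sumrB; congr (_ - _); rewrite big_ord_recr /= subSS subnn mulr0 addr0 mulr_sumr.
  apply: eq_bigr => i _; rewrite subSS -(subnSK (ltn_ord i)); ring.
have := IH n; move: (\sum_(m < n) _) => S HS.
have -> : u * S = - (u * E`_n *+ n) by rewrite -mulrnAr HS mulrN opprK.
by rewrite mulrSr; ring.
Qed.

(** Induction through Newton's identities. With y = x (1 + 2 k), bounding m + 1 by n + 1 cancels the
    factor n + 1 on the left, and y - x = 2 k x turns the remaining sum into y^(n+1) - x^(n+1). *)
Lemma coef_rprod_bound (us : seq C) (k x : R) n : 0 <= k -> 0 <= x ->
    (forall m, (0 < m)%N -> cabs (psum us m) <= 2 * k * m%:R * x ^+ m) ->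
  cabs (\prod_(u <- us) (1 - u *: 'X))`_n <= (x * (1 + 2 * k)) ^+ n.
Proof.
move=> k0 x0 H; elim/ltn_ind: n => -[_|n IH].
  rewrite expr0 -horner_coef0 horner_prod big1 ?cabs1 // => u _.
  by rewrite !(hornerE, mulr0, subr0).
set E := \prod_(_ <- us) _ in IH *; set y := x * (1 + 2 * k).
have y0 : 0 <= y by rewrite mulr_ge0 // addr_ge0 // mulr_ge0.
rewrite -(@ler_pM2l _ n.+1%:R) ?ltr0n //.
rewrite -[X in X * cabs _]cabs_nat -cabsM mulr_natl newton_identities cabsN.
apply: le_trans (cabs_sum _ _ _) _.
apply: le_trans (_ : \sum_(m < n.+1) n.+1%:R * ((2 * k) * x ^+ m.+1 * y ^+ (n - m)) <= _).
  apply: ler_sum => m _; rewrite cabsM subSS.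
  apply: le_trans (_ : (2 * k * m.+1%:R * x ^+ m.+1) * y ^+ (n - m) <= _).
    by rewrite ler_pM ?cabs_ge0 ?H ?IH // ltnS leq_subr.
  rewrite mulrA ler_wpM2r ?exprn_ge0 // mulrA ler_wpM2r ?exprn_ge0 //.
  by rewrite mulrC ler_wpM2r ?mulr_ge0 // ler_nat.
rewrite -mulr_sumr ler_wpM2l //.
suff : \sum_(m < n.+1) 2 * k * x ^+ m.+1 * y ^+ (n - m) = y ^+ n.+1 - x ^+ n.+1.
  by move=> ->; rewrite gerBl exprn_ge0.
have := subrXX y x n.+1; have -> : y - x = 2 * k * x by rewrite /y; ring.
move=> ->; rewrite mulr_sumr; apply: eq_bigr => m _; rewrite exprS; ring.
Qed.

(** [ln_rprod] sees only the modulus; here the argument matters too, so the power sums are converted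
    into coefficients, which at 1 sum geometrically. *)
Lemma rprod1_near1 (us : seq C) (k x : R) : 0 <= k -> 0 <= x ->
    (forall m, (0 < m)%N -> cabs (psum us m) <= 2 * k * m%:R * x ^+ m) ->
    x * (1 + 2 * k) <= 2^-1 ->
  cabs (rprod us 1 - 1) <= 2 * (x * (1 + 2 * k)).
Proof.
move=> k0 x0 H y2; set y := x * _ in y2 *.
have y0 : 0 <= y by rewrite mulr_ge0 // addr_ge0 // mulr_ge0.
pose E : {poly C} := \prod_(u <- us) (1 - u *: 'X).
have -> : rprod us 1 = E.[1].
  by rewrite horner_prod; apply: eq_bigr => u _; rewrite !hornerE.
have E0 : E`_0 = 1.
  rewrite -horner_coef0 horner_prod big1 // => u _.
  by rewrite !(hornerE, mulr0, subr0).
rewrite (horner_coef_wide _ (leqnSn _)) big_ord_recl E0 expr0 mulr1 addrAC subrr add0r.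
apply: le_trans (cabs_sum _ _ _) _.
apply: le_trans (_ : \sum_(i < size E) y * 2^-1 ^+ i <= _).
  apply: ler_sum => i _; rewrite expr1n mulr1 lift0.
  apply: le_trans (coef_rprod_bound _ k0 x0 H) _; rewrite -/y exprS.
  by rewrite ler_wpM2l // lerXn2r ?nnegrE.
by rewrite -mulr_sumr mulrC ler_wpM2r // sum_half_le.
Qed.

End LogSeries.

(** * Blaschke factors and Jensen's inequality *)

Section Blaschke.
Variable R : realType.
Local Notation C := R[i].
Implicit Types (z x : C) (t r M : R) (xs ws : seq C) (P G : {poly C}).

(** On |z| = t each factor has the modulus of z - x, but for nonzero x its root is the reflected
    point t^2 / conj x. This is the denominator of a Blaschke product, kept apart so that everything
    remains polynomial. *)
Definition blaschke_den xs t : {poly C} :=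
  \prod_(x <- xs) (t%:C%C%:P - (x^*%C / t%:C%C) *: 'X).

Lemma blaschke_circle z x t : 0 < t -> cabs z = t ->
  cabs (z - x) = cabs (t%:C%C - x^*%C / t%:C%C * z).
Proof.
move=> t0 zt; have tn0 : t%:C%C != 0 :> C by rewrite -cabs_gt0 cabs_real gtr0_norm.
have -> : t%:C%C - x^*%C / t%:C%C * z = z * (z - x)^*%C / t%:C%C.
  apply: (mulIf tn0); rewrite divfK // mulrBl.
  have -> : x^*%C / t%:C%C * z * t%:C%C = x^*%C * z by field.
  by rewrite rmorphB mulrBr mulJc zt rmorphXn [z * x^*%C]mulrC -expr2.
by rewrite !cabsM cabs_conj cabsV cabs_real gtr0_norm // zt mulrAC divff ?gt_eqF // mul1r.
Qed.

Lemma horner_blaschke_den xs t z : (blaschke_den xs t).[z] =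
  \prod_(x <- xs) (t%:C%C - x^*%C / t%:C%C * z).
Proof.
by rewrite horner_prod; apply: eq_bigr => x _;
  rewrite !(hornerD, hornerN, hornerC, hornerZ, hornerX).
Qed.

Lemma horner_prodXsubC xs z :
  (\prod_(x <- xs) ('X - x%:P)).[z] = \prod_(x <- xs) (z - x).
Proof. by rewrite horner_prod; apply: eq_bigr => x _; rewrite hornerXsubC. Qed.

Lemma blaschke_den_circle xs t z : 0 < t -> cabs z = t ->
  cabs (blaschke_den xs t).[z] = cabs (\prod_(x <- xs) ('X - x%:P)).[z].
Proof.
move=> t0 zt; rewrite horner_blaschke_den horner_prodXsubC !cabs_prod.
by apply: eq_bigr => x _; rewrite -blaschke_circle.
Qed.

Lemma prod_const_seq (T : Type) (s : seq T) (y : R) :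
  \prod_(x <- s) y = y ^+ size s.
Proof. by elim: s => [|a s IH]; rewrite ?big_nil // big_cons IH exprS. Qed.

(** Trading the factors ['X - x] for their reflections keeps the bound M on the circle and turns
    each |x| into t in the value at 0; Cauchy's estimate at index 0 concludes. *)
Lemma jensen P xs G t M : 0 < t -> P = \prod_(x <- xs) ('X - x%:P) * G ->
    (forall z, cabs z = t -> cabs P.[z] <= M) ->
  cabs P.[0] * t ^+ size xs <= M * \prod_(x <- xs) cabs x.
Proof.
move=> t0 EP HM; pose B := G * blaschke_den xs t.
have HB z : cabs z = t -> cabs B.[z] <= M.
  move=> zt; apply: le_trans (HM z zt); rewrite EP !hornerM !cabsM mulrC.
  by rewrite (blaschke_den_circle _ t0 zt).
have := cauchy_coef 0 (ltW t0) HB; rewrite expr0 mulr1 -horner_coef0 => B0.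
rewrite EP; apply: le_trans (_ : cabs B.[0] * \prod_(x <- xs) cabs x <= _).
  rewrite !hornerM !cabsM horner_prodXsubC horner_blaschke_den !cabs_prod.
  rewrite le_eqVlt; apply/orP; left; apply/eqP.
  have -> : \prod_(x <- xs) cabs (0 - x) = \prod_(x <- xs) cabs x.
    by apply: eq_bigr => x _; rewrite sub0r cabsN.
  have -> : \prod_(x <- xs) cabs (t%:C%C - x^*%C / t%:C%C * 0) = t ^+ size xs.
    by rewrite -prod_const_seq; apply: eq_bigr => x _; rewrite mulr0 subr0 cabs_real gtr0_norm.
  by ring.
by rewrite ler_wpM2r // prodr_ge0 // => x _; apply: cabs_ge0.
Qed.

Lemma prodr_seq_gt0 (T : eqType) (s : seq T) (F : T -> R) :
  (forall y, y \in s -> 0 < F y) -> 0 < \prod_(x <- s) F x.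
Proof.
move=> H; rewrite big_seq; elim/big_rec: _ => // y u /H y0 u0; exact: mulr_gt0.
Qed.

(** Jensen at radius r would cost e^r. At a smaller radius t it costs e^t, and each root pays a
    factor r / t; the roots beyond t have t / |x| <= 1 and are dropped. *)
Lemma prod_ratio_bound P xs G t r : cabs P.[0] = 1 ->
    (forall z, cabs P.[z] <= expR (cabs z)) ->
    P = \prod_(x <- xs) ('X - x%:P) * G -> (forall x, x \in xs -> x != 0) ->
    0 < t -> t <= r ->
  \prod_(x <- xs) (r / cabs x) <= expR t * (r / t) ^+ size xs.
Proof.
move=> P0 HP EP xs0 t0 tr; have r0 := lt_le_trans t0 tr.
have -> : \prod_(x <- xs) (r / cabs x) = \prod_(x <- xs) (t / cabs x) * (r / t) ^+ size xs.
  rewrite -prod_const_seq -big_split /= big_seq [RHS]big_seq.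
  apply: eq_bigr => x /xs0; rewrite -cabs_gt0 => x0; field.
  by rewrite !gt_eqF.
rewrite ler_wpM2r ?exprn_ge0 ?divr_ge0 ?(ltW r0) ?(ltW t0) //.
pose ys := [seq x <- xs | cabs x <= t].
apply: le_trans (_ : \prod_(x <- ys) (t / cabs x) <= _).
  rewrite big_filter [leLHS](bigID (fun x => cabs x <= t)) /=.
  rewrite ler_piMr ?prodr_ge0 // => [x _|]; first by rewrite divr_ge0 ?cabs_ge0 ?(ltW t0).
  rewrite big_seq_cond; apply: prodr_ile1 => x /andP[/xs0 x0]; rewrite -ltNge => xt.
  by rewrite divr_ge0 ?cabs_ge0 ?(ltW t0) //= ler_pdivrMr ?cabs_gt0 // mul1r ltW.
have EP' : P = \prod_(x <- ys) ('X - x%:P) *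
    (\prod_(x <- [seq x <- xs | ~~ (cabs x <= t)]) ('X - x%:P) * G).
  by rewrite EP mulrA !big_filter [in LHS](bigID (fun x : C => cabs x <= t)).
have Ht z : cabs z = t -> cabs P.[z] <= expR t by move=> <-.
have := jensen t0 EP' Ht; rewrite P0 mul1r.
have ys0 : 0 < \prod_(x <- ys) cabs x.
  by apply: prodr_seq_gt0 => x; rewrite mem_filter => /andP[_ /xs0]; rewrite cabs_gt0.
rewrite -ler_pdivrMr //; apply: le_trans.
by rewrite big_split /= prod_const_seq prodfV.
Qed.

(** The polynomial B below has no root in |z| < r, so its logarithm is nearly linear, with slope b.
    Going back to P multiplies by Blaschke factors: from above each is at most 3 on half the disk,
    from below the distances to the roots have to be kept. *)
Lemma blaschke_approx P xs ws (a : C) r (d : R) :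
    cabs P.[0] = 1 -> (forall z, cabs P.[z] <= expR (cabs z)) ->
    P = a *: (\prod_(x <- xs) ('X - x%:P) * \prod_(w <- ws) ('X - w%:P)) ->
    (forall x, x \in xs -> cabs x <= r) -> (forall w, w \in ws -> r < cabs w) ->
    1 <= r -> 0 <= d <= 2^-1 ->
  exists b : C, forall z, cabs z <= d * r / 2 ->
    cabs P.[z] <= 3 ^+ size xs * \prod_(x <- xs) (r / cabs x)
                    * expR (Re (b * z) + 8 * r * d ^+ 2) /\
    expR (Re (b * z) - 8 * r * d ^+ 2) * \prod_(x <- xs) cabs (z - x)
      <= cabs P.[z] * (2 * r) ^+ size xs.
Proof.
move=> P0 HP EP Hx Hw r1 /andP[d0 d2].
have r0 : 0 < r by apply: lt_le_trans r1.
have rn0 : r%:C%C != 0 :> C by rewrite -cabs_gt0 cabs_real gtr0_norm.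
have Pn0 : P.[0] != 0 by rewrite -cabs_gt0 P0.
have xs0 x : x \in xs -> x != 0.
  move=> xxs; apply/eqP => x0; move/eqP: Pn0; apply; rewrite EP hornerZ hornerM.
  by rewrite horner_prodXsubC (big_rem x) //= x0 subrr !mul0r mulr0.
have ws0 w : w \in ws -> w != 0.
  by move=> /Hw rw; rewrite -cabs_gt0 (lt_trans r0).
pose G := a *: \prod_(w <- ws) ('X - w%:P).
have EPG : P = \prod_(x <- xs) ('X - x%:P) * G by rewrite EP scalerAr.
pose B := G * blaschke_den xs r.
(* The inverse roots of B, from the far roots [w] and from the reflections r^2 / conj x; all have
   modulus at most 1 / r. *)
pose vs := [seq w^-1 | w <- ws] ++ [seq x^*%C / r%:C%C ^+ 2 | x <- xs].
have EB z : B.[z] = B.[0] * rprod vs z.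
  rewrite !hornerM !hornerZ !horner_prodXsubC !horner_blaschke_den /rprod big_cat !big_map /=.
  have -> : \prod_(x <- ws) (z - x) = \prod_(x <- ws) (0 - x) * \prod_(j <- ws) (1 - j^-1 * z).
    rewrite -big_split /= big_seq [RHS]big_seq; apply: eq_bigr => w /ws0 w0.
    by field.
  have -> : \prod_(x <- xs) (r%:C%C - x^*%C / r%:C%C * z) =
     \prod_(x <- xs) (r%:C%C - x^*%C / r%:C%C * 0) * \prod_(x <- xs) (1 - x^*%C / r%:C%C ^+ 2 * z).
    rewrite -big_split /=; apply: eq_bigr => x _; by field.
  by ring.
have vsr v : v \in vs -> cabs v * (r / 2) <= 2^-1.
  move=> vv; rewrite mulrA ler_pdivrMr // mulVf ?pnatr_eq0 //.
  move: vv; rewrite mem_cat => /orP[/mapP[w /Hw rw ->]|/mapP[x /Hx xr ->]].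
    by rewrite cabsV mulrC ler_pdivrMr ?mul1r ?(ltW rw) // (lt_trans r0).
  rewrite cabsM cabs_conj cabsV cabsX cabs_real gtr0_norm //.
  have -> : cabs x / r ^+ 2 * r = cabs x / r by field; rewrite gt_eqF.
  by rewrite ler_pdivrMr ?mul1r.
have B0E : cabs B.[0] = \prod_(x <- xs) (r / cabs x).
  rewrite big_split /= prodfV prod_const_seq.
  have := P0; rewrite EPG !hornerM !cabsM horner_prodXsubC horner_blaschke_den !cabs_prod.
  have -> : \prod_(x <- xs) cabs (0 - x) = \prod_(x <- xs) cabs x.
    by apply: eq_bigr => x _; rewrite sub0r cabsN.
  have -> : \prod_(x <- xs) cabs (r%:C%C - x^*%C / r%:C%C * 0) = r ^+ size xs.
    by rewrite -prod_const_seq; apply: eq_bigr => x _; rewrite mulr0 subr0 cabs_real gtr0_norm.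
  move: (cabs G.[0]) => g; have : 0 < \prod_(x <- xs) cabs x.
    by apply: prodr_seq_gt0 => x /xs0; rewrite cabs_gt0.
  move: (\prod_(_ <- _) _) => p p0 pg.
  have -> : g = p^-1 by apply: (mulfI (lt0r_neq0 p0)); rewrite pg divff ?gt_eqF.
  by rewrite mulrC.
have B01 : 1 <= cabs B.[0].
  rewrite B0E big_seq; elim/big_rec: _ => // x y xx y1.
  by rewrite -[leLHS]mul1r ler_pM // ler_pdivlMr ?mul1r ?Hx // cabs_gt0 xs0.
have B0gt := lt_le_trans ltr01 B01.
have HBc z : cabs z = r -> cabs B.[z] <= expR r.
  move=> zt; apply: le_trans (_ : cabs P.[z] <= _); last by rewrite -zt.
  by rewrite EPG !hornerM !cabsM mulrC (blaschke_den_circle _ r0 zt).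
(* The factor 2 of [cauchy_half] is absorbed into a second e^r, as r >= 1. *)
have HE z : cabs z = r / 2 -> cabs (rprod vs z) <= expR (2 * r).
  move=> zt; apply: le_trans (_ : cabs B.[z] <= _).
    by rewrite EB cabsM ler_peMl ?cabs_ge0.
  apply: le_trans (cauchy_half (ltW r0) HBc _) _; first by rewrite zt.
  have -> : 2 * r = r + r by ring.
  rewrite expRD ler_wpM2r ?expR_ge0 //; apply: le_trans (expR_ge1Dx _); lra.
exists (- psum vs 1) => z zd.
have r20 : 0 < r / 2 by rewrite divr_gt0.
have M0 : 0 <= 2 * r by rewrite mulr_ge0 // ltW.
have zd' : cabs z <= d * (r / 2) by rewrite mulrA.
have zr2 : cabs z <= r / 2.
  by apply: le_trans zd' _; rewrite ler_piMl ?(ltW r20) //; apply: le_trans d2 _;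
    rewrite invf_le1 ?ler1n.
have := ln_rprod_linear r20 M0 d0 d2 vsr HE zd'.
have En0 : 0 < cabs (rprod vs z).
  rewrite cabs_gt0; apply: rprod_neq0 => v /vsr H.
  apply: le_lt_trans (_ : cabs v * (r / 2) < 1); first by rewrite ler_wpM2l ?cabs_ge0.
  by apply: le_lt_trans H _; rewrite invf_lt1 ?ltr1n.
rewrite ler_norml mulNr ReN => /andP[Elo Ehi].
have PB : P.[z] * (blaschke_den xs r).[z] = B.[z] * \prod_(x <- xs) (z - x).
  by rewrite EPG !hornerM horner_prodXsubC; ring.
move: PB; rewrite EB; move: (rprod vs z) En0 Elo Ehi => E En0 Elo Ehi.
move=> /(congr1 (@Normc.normc R)).
rewrite !cabsM horner_blaschke_den !cabs_prod => PB.
have Dlo : (r / 2) ^+ size xs <= \prod_(x <- xs) cabs (r%:C%C - x^*%C / r%:C%C * z).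
  rewrite -prod_const_seq big_seq [leRHS]big_seq; apply: ler_prod => x xx; rewrite (ltW r20) /=.
  apply: le_trans (cabsB_ge _ _);
    rewrite cabs_real gtr0_norm // !cabsM cabs_conj cabsV cabs_real gtr0_norm //.
  suff : cabs x / r * cabs z <= 1 * (r / 2) by lra.
  by rewrite ler_pM ?cabs_ge0 ?divr_ge0 ?cabs_ge0 ?(ltW r0) // ler_pdivrMr // mul1r Hx.
have Dhi : \prod_(x <- xs) cabs (r%:C%C - x^*%C / r%:C%C * z) <= (2 * r) ^+ size xs.
  rewrite -prod_const_seq big_seq [leRHS]big_seq; apply: ler_prod => x xx; rewrite cabs_ge0 /=.
  apply: le_trans (cabsB _ _) _;
    rewrite cabs_real gtr0_norm // !cabsM cabs_conj cabsV cabs_real gtr0_norm //.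
  suff : cabs x / r * cabs z <= 1 * (r / 2) by lra.
  by rewrite ler_pM ?cabs_ge0 ?divr_ge0 ?cabs_ge0 ?(ltW r0) // ler_pdivrMr // mul1r Hx.
have Ahi : \prod_(x <- xs) cabs (z - x) <= 3 ^+ size xs * (r / 2) ^+ size xs.
  rewrite -exprMn -prod_const_seq big_seq [leRHS]big_seq; apply: ler_prod => x xx;
    rewrite cabs_ge0 /=.
  by apply: le_trans (cabsB _ _) _; have := Hx x xx; lra.
move: PB Dlo Dhi Ahi; set D := \prod_(x <- xs) cabs (_ - _ * z);
  set A := \prod_(x <- xs) cabs (z - x).
move=> PB Dlo Dhi Ahi.
have D0 : 0 < D by apply: lt_le_trans Dlo; rewrite exprn_gt0.
have A0 : 0 <= A by apply: prodr_ge0 => x _; apply: cabs_ge0.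
split.
  rewrite -(ler_pM2r D0) PB -B0E.
  apply: le_trans (_ : cabs B.[0] * expR (- Re (psum vs 1 * z) + 8 * r * d ^+ 2) * (3 ^+ size xs * (r / 2) ^+ size xs) <= _).
    rewrite ler_pM ?mulr_ge0 ?cabs_ge0 // ler_wpM2l ?cabs_ge0 //.
    rewrite -[leLHS]lnK ?posrE // ler_expR; move: Ehi; set u := ln _; lra.
  rewrite mulrCA mulrA [leRHS](_ : _ = 3 ^+ size xs * (cabs B.[0] *
            expR (- Re (psum vs 1 * z) + 8 * r * d ^+ 2)) * D); last by ring.
  by rewrite ler_wpM2l // mulr_ge0 ?exprn_ge0 // mulr_ge0 ?cabs_ge0 ?expR_ge0.
apply: le_trans (_ : cabs P.[z] * D <= _); last by rewrite ler_wpM2l ?cabs_ge0.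
rewrite PB ler_wpM2r //; apply: le_trans (_ : cabs E <= _).
  rewrite -[leRHS]lnK ?posrE // ler_expR; move: Elo; set u := ln _; lra.
by rewrite ler_peMl ?cabs_ge0.
Qed.

End Blaschke.

(** * Few roots in a disk force nearly exponential growth on a smaller one *)

Section FewRoots.
Variable R : realType.
Local Notation C := R[i].
Implicit Types (z x : C) (t r M : R) (xs ws : seq C) (P G : {poly C}).

(* Each small zero costs at most a factor [3] (inverse Blaschke factor on a smaller
   disk) times [8000 * 8000] (ratio of the radii at which Jensen's bound is used);
   the density below makes the total cost a small power of [e ^ r]. *)
Definition blaschke_loss : R := 3 * (8000 * 8000).

Definition zero_density : R := (16 * 1000)^-1 / 4000 / ln blaschke_loss.

Lemma blaschke_loss_gt1 : 1 < blaschke_loss.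
Proof. rewrite /blaschke_loss; lra. Qed.

Lemma zero_density_gt0 : 0 < zero_density.
Proof.
rewrite /zero_density; apply: divr_gt0; first by lra.
exact: ln_gt0 blaschke_loss_gt1.
Qed.

Lemma blaschke_loss_gt0 : 0 < blaschke_loss.
Proof. exact: lt_trans ltr01 blaschke_loss_gt1. Qed.

Lemma exprn_blaschke_loss k r : k%:R <= zero_density * r ->
  blaschke_loss ^+ k <= expR (r / (32 * 1000) / 2000).
Proof.
move=> kr; have L0 : 0 < ln blaschke_loss := ln_gt0 blaschke_loss_gt1.
have b0 := blaschke_loss_gt0.
rewrite -{1}[blaschke_loss]lnK ?posrE // -expRM_natl ler_expR.
apply: le_trans (_ : zero_density * r * ln blaschke_loss <= _).
  exact: ler_wpM2r (ltW L0) _ _ kr.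
rewrite /zero_density le_eqVlt; apply/orP; left; apply/eqP.
by field; rewrite gt_eqF.
Qed.

(** The last growth hypothesis is that of a long Taylor polynomial with coefficients of modulus 1 /
    n!. Of the error 6 rho / 1000, a part 2 rho / 1000 comes from [blaschke_approx] and the loss at
    the roots, and 4 rho / 1000 from normalising the slope to modulus 1. *)
Lemma exp_type_of_few_roots P xs ws (a : C) r (rho := r / (32 * 1000)) :
    cabs P.[0] = 1 -> (forall z, cabs P.[z] <= expR (cabs z)) ->
    P = a *: (\prod_(x <- xs) ('X - x%:P) * \prod_(w <- ws) ('X - w%:P)) ->
    (forall x, x \in xs -> cabs x <= r) -> (forall w, w \in ws -> r < cabs w) ->
    (size xs)%:R <= zero_density * r -> 2 * 1000 * 1000 <= rho ->
    expR (999 / 1000 * rho) / 2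
      <= \sum_(n < size P) cabs P`_n * (999 / 1000 * rho) ^+ n ->
  exists2 al : C, cabs al = 1 &
    forall z, cabs z <= rho -> cabs P.[z] <= expR (Re (al * z) + 6 / 1000 * rho).
Proof.
move=> P0 HP EP Hx Hw Hk rho_ge Hlow.
have rE : r = rho * (32 * 1000) by rewrite /rho; field.
clearbody rho.
have rho0 : 0 < rho by lra.
have r1 : 1 <= r by lra.
have r0 : 0 < r by lra.
have h2000 : 2000 <= expR (rho / 1000).
  by apply: le_trans (expR_ge1Dx _); lra.
have tr : rho / 2000 <= r by lra.
clear rho_ge.
(* Makes d r / 2 equal to rho and the quadratic error 8 r d^2 equal to rho / 1000. *)
pose d : R := (16 * 1000)^-1.
have dI : 0 <= d <= 2^-1 by rewrite /d; lra.
have [be Hbe] := blaschke_approx P0 HP EP Hx Hw r1 dI.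
have dr : d * r / 2 = rho by rewrite /d rE; field.
have dd : 8 * r * d ^+ 2 = rho / 1000 by rewrite /d rE; field.
rewrite dr dd in Hbe; clear d dI dr dd.
have := exprn_blaschke_loss Hk; have -> : r / (32 * 1000) = rho by rewrite rE; field.
rewrite /blaschke_loss exprMn => kL.
clear Hk.
have E1 : r / (rho / 2000) = 8000 * 8000 by rewrite rE; field; rewrite gt_eqF.
have E2 : 2 * r / (rho / 1000) = 8000 * 8000 by rewrite rE; field; rewrite gt_eqF.
have K0 : 0 <= 8000 * 8000 :> R by clear; lra.
move: (8000 * 8000) K0 E1 E2 kL => K K0 E1 E2 kL.
clear rE.
have xs0 x : x \in xs -> x != 0.
  move=> xxs; apply/eqP => x0.
  have : P.[0] != 0 by rewrite -cabs_gt0 P0.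
  by rewrite EP hornerZ hornerM horner_prodXsubC (big_rem x) //= x0 subrr !mul0r mulr0 eqxx.
have Hup z : cabs z <= rho -> cabs P.[z] <= expR (Re (be * z) + rho / 500).
  move=> zr; have [H _] := Hbe z zr; apply: le_trans H _.
  have EPG : P = \prod_(x <- xs) ('X - x%:P) * (a *: \prod_(w <- ws) ('X - w%:P)).
    by rewrite EP scalerAr.
  have t0 : 0 < rho / 2000 by clear -rho0; lra.
  have := prod_ratio_bound P0 HP EPG xs0 t0 tr.
  rewrite E1 => Hr;
    apply: le_trans (_ : (3 ^+ size xs * (expR (rho / 2000) * K ^+ size xs)) * expR (Re (be * z) + rho / 1000) <= _).
    by rewrite ler_wpM2r ?expR_ge0 // ler_wpM2l // exprn_ge0.
  clear Hr; rewrite mulrCA.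
  apply: le_trans (_ : expR (rho / 2000) * expR (rho / 2000) * expR (Re (be * z) + rho / 1000) <= _).
    by apply: ler_wpM2r; rewrite ?expR_ge0 //; apply: ler_wpM2l; rewrite ?expR_ge0.
  have e3 (x y w : R) : expR x * expR y * expR w = expR (x + y + w) by rewrite !expRD.
  by rewrite e3 ler_expR; clear; move: (Re _) => X; lra.
have be_up : cabs be <= 1 + 4 / 1000.
  have [->|bn0] := eqVneq be 0; first by rewrite cabs0; clear; lra.
  have b_gt0 : 0 < cabs be by rewrite cabs_gt0.
  pose s := rho / 1000; have s0 : 0 < s by rewrite /s; clear -rho0; lra.
  pose u := be^*%C / (cabs be)%:C%C.
  have u1 : cabs u = 1 by rewrite cabsM cabs_conj cabsV cabs_real gtr0_norm // divff ?gt_eqF.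
  have beu : be * u = (cabs be)%:C%C.
    rewrite /u mulrA mulJc rmorphXn expr2 mulfK //.
    by rewrite -cabs_gt0 cabs_real gtr0_norm.
  pose z0 := (rho - s)%:C%C * u.
  have z0E : cabs z0 = rho - s by rewrite cabsM u1 mulr1 cabs_real ger0_norm // /s;
    clear -rho0; lra.
  (* Roots may lie close to [z0], where Re (be z) is large. But by Cauchy for the leading
     coefficient, a monic polynomial of degree k reaches s^k somewhere on |w| = s; at such a point
     |P| <= e^|z| limits |be|. *)
  pose A : {poly C} := \prod_(y <- [seq x - z0 | x <- xs]) ('X - y%:P).
  have A1 : A`_(size xs) = 1.
    have /monicP := monic_prod_XsubC [seq x - z0 | x <- xs] predT id.
    by rewrite lead_coefE size_prod_XsubC size_map.
  have HA w : cabs w = s ->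
    cabs A.[w] <= (2 * r) ^+ size xs * expR (rho + rho / 1000 - cabs be * (rho - 2 * s)).
    move=> ws'; have zr : cabs (z0 + w) <= rho.
      by apply: le_trans (cabsD _ _) _; rewrite z0E ws' subrK.
    have [_] := Hbe _ zr.
    have -> : \prod_(x <- xs) cabs (z0 + w - x) = cabs A.[w].
      rewrite horner_prodXsubC big_map cabs_prod; apply: eq_bigr => x _.
      by rewrite opprB addrA [w + z0]addrC.
    have Hre : cabs be * (rho - 2 * s) <= Re (be * (z0 + w)).
      have bz0 : be * z0 = (rho - s)%:C%C * (cabs be)%:C%C by rewrite /z0 mulrCA beu.
      rewrite [be * _]mulrDr ReD bz0 ReZ /=.
      have := Re_le_cabs (be * w); rewrite cabsM ws' ler_norml => /andP[+ _].
      by clear; move: (Re _) (cabs be) => X b; nra.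
    have HPz : cabs P.[z0 + w] <= expR rho.
      by apply: le_trans (HP _) _; rewrite ler_expR.
    move=> H.
    have : expR (cabs be * (rho - 2 * s) - rho / 1000) * cabs A.[w] <= expR rho * (2 * r) ^+ size xs.
      apply: le_trans (_ : expR (Re (be * (z0 + w)) - rho / 1000) * cabs A.[w] <= _).
        by rewrite ler_wpM2r ?cabs_ge0 // ler_expR lerD2r.
      apply: le_trans H _; rewrite ler_wpM2r // exprn_ge0 // mulr_ge0 // ltW //.
    rewrite -ler_pdivlMl ?expR_gt0 // -expRN => /le_trans; apply.
    rewrite mulrA -expRD mulrC ler_wpM2l ?exprn_ge0 ?mulr_ge0 ?(ltW r0) //.
    by rewrite ler_expR; clear; move: (cabs be) => b; lra.
  have := cauchy_coef (size xs) (ltW s0) HA; rewrite A1 cabs1 mul1r => Hs.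
  have : 1 <= (2 * r / s) ^+ size xs * expR (rho + rho / 1000 - cabs be * (rho - 2 * s)).
    rewrite expr_div_n mulrAC ler_pdivlMr ?exprn_gt0 // mul1r //.
  rewrite E2 => H.
  have : 1 <= expR (rho / 2000 + (rho + rho / 1000 - cabs be * (rho - 2 * s))).
    apply: le_trans H _; rewrite [leRHS]expRD.
    apply: ler_wpM2r; first exact: expR_ge0.
    by apply: le_trans kL; rewrite ler_peMl ?exprn_ge0 // exprn_ege1 // ler1n.
  rewrite -[leLHS]expR0 ler_expR /s => {}H.
  have : cabs be * (998 / 1000) * rho <= (1 + 3 / 2000) * rho.
    by move: H; clear; move: (cabs be) => b; lra.
  by rewrite (ler_pM2r rho0); clear; move: (cabs be) => X; lra.
(* Cauchy on |z| = rho bounds the sum in [Hlow] by a geometric series of ratio 999/1000, hence by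
   1000 Mx; the resulting factor 2000 is at most e^(rho / 1000), so a small |be| would contradict
   [Hlow]. *)
have be_lo : 1 - 4 / 1000 <= cabs be.
  pose Mx := expR (cabs be * rho + rho / 500).
  have HM z : cabs z = rho -> cabs P.[z] <= Mx.
    move=> zr; apply: le_trans (Hup z _) _; first by rewrite zr.
    rewrite ler_expR lerD2r -zr -cabsM; apply: le_trans (Re_le_cabs _); exact: ler_norm.
  have Hc n : cabs P`_n * rho ^+ n <= Mx by apply: cauchy_coef HM; apply: ltW.
  have : expR (999 / 1000 * rho) / 2 <= 1000 * Mx.
    apply: le_trans Hlow _.
    apply: le_trans (_ : \sum_(n < size P) (999 / 1000) ^+ n * Mx <= _).
      apply: ler_sum => n _; rewrite exprMn mulrCA; apply: ler_wpM2l (Hc n).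
      by apply: exprn_ge0; clear; lra.
    rewrite -mulr_suml; apply: ler_wpM2r; first exact: expR_ge0.
    have := subrX1 (999 / 1000 : R) (size P).
    have : 0 <= (999 / 1000 : R) ^+ size P by apply: exprn_ge0; clear; lra.
    by clear; move: (\sum_(_ < _) _) (_ ^+ _) => S X; lra.
  rewrite ler_pdivrMr // => H.
  have : expR (999 / 1000 * rho) <= expR (rho / 1000) * Mx.
    apply: le_trans H _; rewrite mulrAC ler_wpM2r ?expR_ge0 //.
    by apply: le_trans h2000; clear; lra.
  rewrite /Mx -expRD ler_expR => {}H.
  have : (999 / 1000 - 1 / 1000 - 1 / 500) * rho <= cabs be * rho.
    by move: H; clear; move: (cabs be) => b; lra.
  by rewrite (ler_pM2r rho0); clear; move: (cabs be) => X; lra.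
have bgt0 : 0 < cabs be by apply: lt_le_trans be_lo; clear; lra.
exists (be / (cabs be)%:C%C).
  by rewrite cabsM cabsV cabs_real gtr0_norm // divff ?gt_eqF.
move=> z zr; apply: le_trans (Hup z zr) _; rewrite ler_expR.
suff : Re (be * z) - Re (be / (cabs be)%:C%C * z) <= 4 / 1000 * rho.
  by clear; move: (Re _) (Re _) => X Y; lra.
rewrite -ReN -ReD -mulNr -mulrDl.
apply: le_trans (ler_norm _) _; apply: le_trans (Re_le_cabs _) _; rewrite cabsM.
rewrite ler_pM ?cabs_ge0 //.
have -> : be - be / (cabs be)%:C%C = be / (cabs be)%:C%C * (cabs be - 1)%:C%C.
  rewrite rmorphB mulrBr mulr1 divfK // -cabs_gt0 cabs_real gtr0_norm //.
rewrite !cabsM cabsV !cabs_real (gtr0_norm bgt0) divff ?gt_eqF // mul1r.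
by move: be_up be_lo; clear; move: (cabs be) => b; rewrite ler_norml; lra.
Qed.

End FewRoots.

(** * Iterated differences of the rotated coefficients *)

Section Differences.
Variable R : realType.
Local Notation C := R[i].
Implicit Types (a : nat -> C) (z w : C).

Definition fdiff a n : C := a n.+1 - a n.

Lemma iter_fdiffE a j n :
  iter j fdiff a n = \sum_(i < j.+1) (-1) ^+ i * 'C(j, i)%:R * a (n + (j - i))%N.
Proof.
elim: j n => [|j IH] n.
  by rewrite big_ord_recl big_ord0 /= expr0 bin0 !mul1r addr0 addn0.
rewrite iterS /fdiff !IH big_ord_recl [RHS]big_ord_recl /= !expr0 !bin0 !mul1r !subn0.
rewrite addSnnS -addrA; congr (_ + _).
rewrite [in RHS]big_ord_recr /= /bump leq0n add1n binn subnn addn0.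
rewrite [X in _ - X]big_ord_recr /= binn subnn addn0 exprS.
have -> : \sum_(i < j) (-1) ^+ (1 + i) * 'C(j.+1, 1 + i)%:R * a (n + (j.+1 - (1 + i)))%N
   = \sum_(i < j) (-1) ^+ (1 + i) * 'C(j, 1 + i)%:R * a (n.+1 + (j - (1 + i)))%N
     - \sum_(i < j) (-1) ^+ i * 'C(j, i)%:R * a (n + (j - i))%N.
  rewrite -sumrB; apply: eq_bigr => i _.
  have ij := ltn_ord i.
  rewrite add1n binS natrD subSS addSnnS subnSK // exprS; ring.
by move: (\sum_(i < j) _) (\sum_(i < j) _) => X Y; ring.
Qed.

Lemma newton_forward a n m : (n < m)%N ->
  a n = \sum_(j < m) 'C(n, j)%:R * iter j fdiff a 0%N.
Proof.
elim: n a m => [|n IH] a [//|m] nm.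
  rewrite big_ord_recl big1 ?addr0 ?bin0 ?mul1r // => i _.
  by rewrite lift0 bin0n mul0r.
have -> : a n.+1 = a n + fdiff a n by rewrite /fdiff addrC subrK.
rewrite {1}(IH a m.+1 (leqW nm)) (IH (fdiff a) m nm).
rewrite big_ord_recl [RHS]big_ord_recl !bin0 -addrA; congr (_ + _).
rewrite -big_split; apply: eq_bigr => i _ /=.
by rewrite /bump leq0n add1n -iterSr binS natrD mulrDl.
Qed.

(** The squared modulus of one factor is 1 + 2 y, which is at most e^(2 y). *)
Lemma cabs_1B_expn z n : (0 < n)%N ->
  cabs (1 - z / n%:R) ^+ n <= expR (- Re z + cabs z ^+ 2 / (2 * n%:R)).
Proof.
move=> n0; have n0' : (0 : R) < n%:R by rewrite ltr0n.
pose y := - Re z / n%:R + cabs z ^+ 2 / (2 * n%:R ^+ 2).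
have -> : - Re z + cabs z ^+ 2 / (2 * n%:R) = n%:R * y.
  by rewrite /y; field; rewrite gt_eqF.
rewrite expRM_natl lerXn2r ?nnegrE ?cabs_ge0 ?expR_ge0 //.
rewrite -ler_sqr ?nnegrE ?cabs_ge0 ?expR_ge0 // -expRM_natl.
apply: le_trans (expR_ge1Dx _).
have -> : z / n%:R = (n%:R^-1)%:C%C * z by rewrite fmorphV rmorph_nat mulrC.
rewrite sqr_cabs_1B /y le_eqVlt; apply/orP; left; apply/eqP; field.
by rewrite gt_eqF.
Qed.

(** Up to the factor (-1)^i / i!, the quotient is the i-th coefficient of (1 - z / n)^n; it tends to
    that of e^(- z) at rate 1 / n. *)
Lemma ffact_ratio n i : (0 < n)%N ->
  `|(n ^_ i)%:R / n%:R ^+ i - 1| <= (i * i)%:R / n%:R :> R.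
Proof.
move=> n0; have n0' : (0 : R) < n%:R by rewrite ltr0n.
have nn0 : (n%:R : R) != 0 by rewrite gt_eqF.
elim: i => [|i IH]; first by rewrite ffactn0 expr0 divr1 subrr normr0 mul0r.
have -> : (n ^_ i.+1)%:R / n%:R ^+ i.+1 - 1 =
   ((n ^_ i)%:R / n%:R ^+ i - 1) - ((n ^_ i)%:R / n%:R ^+ i) * (i%:R / n%:R) :> R.
  rewrite ffactnSr natrM exprSr; have [ni|ni] := leqP i n.
    by rewrite natrB //; field; rewrite expf_neq0 ?nn0.
  by rewrite ffact_small // !mul0r; ring.
apply: le_trans (ler_normB _ _) _.
apply: le_trans (_ : (i * i)%:R / n%:R + 1 * (i%:R / n%:R) <= _).
  apply: lerD => //; rewrite normrM; apply: ler_pM => //; last by rewrite ger0_norm // divr_ge0.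
  rewrite ger0_norm ?divr_ge0 ?exprn_ge0 // ler_pdivrMr ?exprn_gt0 // mul1r -natrX ler_nat.
  by elim: i {IH} => [|i IH]; rewrite ?ffactn0 // ffactnSr expnSr leq_mul // leq_subr.
rewrite mul1r -mulrDl ler_wpM2r ?invr_ge0 // -natrD ler_nat; lia.
Qed.

Lemma le_limit_inv (x y K : R) n0 :
  (forall n, (n0 < n)%N -> x <= y + K / n%:R) -> x <= y.
Proof.
move=> H; apply/ler_addgt0Pr => e e0.
pose n := (n0 + Num.bound `|K / e|).+1.
have n_gt0 : (0 : R) < n%:R by rewrite ltr0n.
apply: le_trans (H n _) _; first by rewrite ltnS leq_addr.
rewrite lerD2l ler_pdivrMr // mulrC -ler_pdivrMr // ltW //.
apply: le_lt_trans (ler_norm _) _; apply: lt_le_trans (archi_boundP (normr_ge0 _)) _.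
rewrite ler_nat (leq_trans _ (leqnSn _)) //; apply: leq_trans (leq_addl n0 _).
by [].
Qed.

Lemma coef_1BZX_exp (c : C) n i :
  ((1 - c *: 'X) ^+ n : {poly C})`_i = (- c) ^+ i *+ 'C(n, i).
Proof.
rewrite -scaleNr exprDn_comm; last exact: commr_sym (commr1 _).
rewrite coef_sum; have [ni|ni] := leqP i n.
  have ni' : (i < n.+1)%N by [].
  rewrite (bigD1 (Ordinal ni')) //= big1 ?addr0 => [|j ji].
    by rewrite expr1n mul1r coefMn exprZn coefZ coefXn eqxx mulr1.
  rewrite expr1n mul1r coefMn exprZn coefZ coefXn.
  case: eqP => [E|_]; last by rewrite mulr0 mul0rn.
  by case/eqP: ji; apply/val_inj; rewrite /= E.
rewrite bin_small // mulr0n big1 // => j _.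
rewrite expr1n mul1r coefMn exprZn coefZ coefXn.
by rewrite gtn_eqF ?mulr0 ?mul0rn // (leq_ltn_trans _ ni) // -ltnS ltn_ord.
Qed.

(* [(1 - al z / n) ^ n] plays the role of [e ^ (- al z)], whose product with the
   generating polynomial has the differences as Taylor coefficients. *)
Lemma fdiff_bound (om : nat -> C) (P : {poly C}) (al : C) (rho tau : R) N j :
    (forall n, (n <= N)%N -> P`_n = om n / n`!%:R) -> cabs al = 1 -> 0 <= rho ->
    (forall z, cabs z <= rho -> cabs P.[z] <= expR (Re (al * z) + tau)) ->
    (j <= N)%N ->
  cabs (iter j fdiff (fun n => om n / al ^+ n) 0%N) / j`!%:R * rho ^+ j
    <= expR (tau + 2^-1).
Proof.
move=> HP al1 rho0 HPb jN.
have aln0 : al != 0 by rewrite -cabs_gt0 al1.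
have fn0 k : (k`!%:R : C) != 0 by rewrite pnatr_eq0 -lt0n fact_gt0.
have -> : cabs (iter j fdiff (fun n => om n / al ^+ n) 0%N) / j`!%:R =
   cabs (\sum_(i < j.+1) (- al) ^+ i / i`!%:R * P`_(j - i)).
  rewrite -[X in _ / X]cabs_nat -cabsV -cabsM iter_fdiffE.
  have c1 : cabs (al ^- j) = 1 by rewrite cabsV cabsX al1 expr1n invr1.
  rewrite -[RHS]mul1r -{1}c1.
  rewrite -cabsM mulr_suml mulr_sumr; congr cabs; apply: eq_bigr => i _.
  have ij : (i <= j)%N by rewrite -ltnS ltn_ord.
  rewrite HP; last by rewrite (leq_trans _ jN) // leq_subr.
  have -> : ('C(j, i)%:R : C) = j`!%:R / (i`!%:R * (j - i)`!%:R).
    by rewrite -(bin_fact ij) !natrM; field; rewrite !fn0.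
  rewrite add0n -[in al ^- j](subnK ij) exprD [(- al) ^+ _]exprNn; field.
  by rewrite !fn0 !expf_neq0.
(* [K / n] bounds the cost of replacing e^(- al z) by (1 - al z / n)^n in coefficient j. Taking n
   above rho^2 makes rho^2 / (2 n) <= 1/2, the origin of [2^-1] in the bound. *)
pose K := \sum_(i < j.+1) (i * i)%:R / i`!%:R * cabs P`_(j - i) * rho ^+ j.
apply: (@le_limit_inv _ _ K (Num.bound `|rho ^+ 2|)) => n nB.
have n0 : (0 < n)%N by apply: leq_ltn_trans nB.
have n0' : (0 : R) < n%:R by rewrite ltr0n.
have nC0 : (n%:R : C) != 0 by rewrite pnatr_eq0 -lt0n.
pose F : {poly C} := (1 - (al / n%:R) *: 'X) ^+ n * P.
have HF z : cabs z = rho -> cabs F.[z] <= expR (tau + 2^-1).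
  move=> zr; rewrite hornerM horner_exp !(hornerD, hornerN, hornerZ, hornerX, hornerC) cabsM cabsX.
  have -> : 1 - al / n%:R * z = 1 - (al * z) / n%:R by field.
  apply: le_trans (_ : expR (- Re (al * z) + cabs (al * z) ^+ 2 / (2 * n%:R)) * expR (Re (al * z) + tau) <= _).
    by rewrite ler_pM ?exprn_ge0 ?cabs_ge0 ?cabs_1B_expn ?HPb ?zr.
  rewrite -expRD ler_expR cabsM al1 mul1r zr.
  suff : rho ^+ 2 / (2 * n%:R) <= 2^-1 by move: (Re _) (_ / _) => X Y; lra.
  rewrite invfM mulrCA ler_piMr ?invr_ge0 // ler_pdivrMr // mul1r ltW //.
  apply: le_lt_trans (ler_norm _) _; apply: lt_le_trans (archi_boundP (normr_ge0 _)) _.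
  by rewrite ler_nat ltnW.
have := cauchy_coef j rho0 HF; rewrite coefM.
under eq_bigr => i _ do rewrite coef_1BZX_exp.
set X := \sum_(_ < _) _; set Y := \sum_(_ < _) _ => HX.
have XY : cabs (Y - X) * rho ^+ j <= K / n%:R.
  rewrite /K /X /Y -sumrB mulr_suml.
  apply: le_trans (_ : (\sum_(i < j.+1) cabs ((- al) ^+ i / i`!%:R * P`_(j - i) - (- (al / n%:R)) ^+ i *+ 'C(n, i) * P`_(j - i))) * rho ^+ j <= _).
    by rewrite ler_wpM2r ?exprn_ge0 ?cabs_sum.
  rewrite mulr_suml; apply: ler_sum => i _.
  have -> : (- al) ^+ i / i`!%:R * P`_(j - i) - (- (al / n%:R)) ^+ i *+ 'C(n, i) * P`_(j - i)
     = (- al) ^+ i * (- ((n ^_ i)%:R / n%:R ^+ i - 1)%:C%C) / i`!%:R * P`_(j - i).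
    rewrite rmorphB rmorph1 rmorphM fmorphV rmorphXn !rmorph_nat.
    have -> : - (al / n%:R) = (- al) / n%:R by rewrite mulNr.
    rewrite expr_div_n.
    rewrite -mulr_natr -bin_ffact natrM; field.
    by rewrite fn0 expf_neq0.
  rewrite !cabsM cabsX cabsN al1 expr1n mul1r cabsN cabs_real cabsV cabs_nat.
  have -> : (i * i)%:R / i`!%:R * cabs P`_(j - i) * rho ^+ j / n%:R =
     (i * i)%:R / n%:R / i`!%:R * cabs P`_(j - i) * rho ^+ j by ring.
  rewrite ler_wpM2r ?exprn_ge0 // ler_wpM2r ?cabs_ge0 //.
  by rewrite ler_wpM2r ?invr_ge0 // ffact_ratio.
apply: le_trans (_ : cabs X * rho ^+ j + cabs (Y - X) * rho ^+ j <= _).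
  rewrite -mulrDl ler_wpM2r ?exprn_ge0 //.
  by apply: le_trans (cabsD _ _); rewrite addrC subrK.
by rewrite lerD.
Qed.

End Differences.
Arguments fdiff {R}.

(** * Newton interpolation of a unimodular sequence *)

Section Interpolation.
Variable R : realType.
Local Notation C := R[i].
Implicit Types (a : nat -> C) (s z w : C) (Q : {poly C}).

Definition newton_interp (dl : nat -> C) K : {poly C} :=
  \sum_(j < K.+1) (dl j / j`!%:R) *: \prod_(l <- iota 0 j) ('X - (l%:R)%:P).

Lemma prod_iota_nat n j :
  \prod_(l <- iota 0 j) (n%:R - l%:R : C) = (n ^_ j)%:R.
Proof.
elim: j => [|j IH]; first by rewrite big_nil ffactn0.
rewrite -addn1 iotaD big_cat /= big_seq1 add0n IH addn1 ffactnSr natrM.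
have [jn|jn] := leqP j n; first by rewrite natrB.
by rewrite ffact_small // !mul0r.
Qed.

Lemma newton_interpE a K n : (n <= K)%N ->
  (newton_interp (fun j => iter j fdiff a 0%N) K).[n%:R] = a n.
Proof.
move=> nK; rewrite (newton_forward a (m := K.+1)) // horner_sum.
apply: eq_bigr => j _; rewrite hornerZ horner_prod.
under eq_bigr do rewrite hornerXsubC.
rewrite prod_iota_nat -bin_ffact natrM.
have fn0 : (j`!%:R : C) != 0 by rewrite pnatr_eq0 -lt0n fact_gt0.
by field.
Qed.

(** Each factor |s - l| is at most |s| + K <= rho / 2, so the j-th term is at most D / 2^j. *)
Lemma newton_interp_bound (dl : nat -> C) K (rho D : R) s : 0 < rho -> 0 <= D ->
    (forall j, (j <= K)%N -> cabs (dl j) / j`!%:R * rho ^+ j <= D) ->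
    cabs s + K%:R <= rho / 2 ->
  cabs (newton_interp dl K).[s] <= 2 * D.
Proof.
move=> rho0 D0 Hd sK; rewrite horner_sum; apply: le_trans (cabs_sum _ _ _) _.
apply: le_trans (_ : \sum_(j < K.+1) D * 2^-1 ^+ j <= _); last first.
  by rewrite -mulr_sumr mulrC ler_wpM2r // sum_half_le.
apply: ler_sum => j _; rewrite hornerZ 2!cabsM cabsV cabs_nat horner_prod cabs_prod.
apply: le_trans (_ : cabs (dl j) / j`!%:R * (rho / 2) ^+ j <= _).
  rewrite ler_wpM2l ?divr_ge0 ?cabs_ge0 //.
  rewrite -{2}(size_iota 0 j) -prod_const_seq big_seq [leRHS]big_seq.
  apply: ler_prod => l; rewrite mem_iota /= add0n => lj; rewrite cabs_ge0 /= hornerXsubC.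
  apply: le_trans (cabsB _ _) _; apply: le_trans sK; rewrite lerD2l cabs_nat ler_nat.
  by rewrite (leq_trans (ltnW lj)) // -ltnS ltn_ord.
by rewrite exprMn mulrA ler_wpM2r ?exprn_ge0 // Hd // -ltnS ltn_ord.
Qed.

(* [Q Q^* - 1] vanishes at [0, .., K], hence is tiny on a disk of radius [K]. *)
Lemma unimodular_interp_neq0 Q K (T : R) : (0 < K)%N ->
    (forall n, (n <= K)%N -> cabs Q.[n%:R] = 1) ->
    (forall s, cabs s <= 7 * K%:R -> cabs Q.[s] <= 2 * expR T) ->
    0 <= T -> 10 * expR (2 * T) < 3 ^+ K.+1 ->
  forall s, cabs s <= K%:R -> Q.[s] != 0.
Proof.
move=> K0 HQ HQb T0 HT s sK; apply/eqP => Qs0.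
have K0' : (0 : R) < K%:R by rewrite ltr0n.
(* Conjugating the coefficients makes [Q * Qc] equal to |Q|^2 on the real line, yet polynomial. *)
pose Qc := map_poly (@conjc R) Q.
have QcE z : Qc.[z] = (Q.[z^*%C])^*%C.
  by rewrite -[z in LHS](conjcK) horner_map.
pose W := Q * Qc - 1.
pose rs : seq C := [seq n%:R | n <- iota 0 K.+1].
have [|| S ES] := @uniq_roots_prod_XsubC _ W rs.
- apply/allP => _ /mapP[n + ->]; rewrite mem_iota /= add0n ltnS => nK.
  rewrite rootE hornerD hornerM hornerN hornerC QcE conjc_nat mulJc HQ //.
  by rewrite expr1n subrr.
- rewrite uniq_rootsE map_inj_uniq ?iota_uniq // => m n /eqP; rewrite eqr_nat => /eqP //.
have WE z : W.[z] = Q.[z] * (Q.[z^*%C])^*%C - 1.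
  by rewrite hornerD hornerM hornerN hornerC QcE.
pose X := expR (2 * T).
have X1 : 1 <= X by rewrite /X -expR0 ler_expR mulr_ge0.
have HW z : cabs z = 7 * K%:R -> cabs W.[z] <= 5 * X.
  move=> zK; rewrite WE; apply: le_trans (cabsB _ _) _; rewrite cabs1 cabsM cabs_conj.
  have -> : 5 * X = (2 * expR T) * (2 * expR T) + X.
    have -> : X = expR T * expR T by rewrite -expRD /X; congr expR; ring.
    by ring.
  by rewrite lerD // ler_pM ?cabs_ge0 // HQb // ?cabs_conj zK.
(* Each factor z - l is at least 6 K on this circle and at most 2 K on the disk of radius K: a gain
   of 3 for each of the K + 1 points. *)
have HS z : cabs z = 7 * K%:R -> cabs S.[z] <= 5 * X / (6 * K%:R) ^+ K.+1.
  move=> zK; rewrite ler_pdivlMr ?exprn_gt0 ?mulr_gt0 //; apply: le_trans (HW z zK).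
  rewrite ES hornerM cabsM ler_wpM2l ?cabs_ge0 // horner_prodXsubC big_map cabs_prod.
  rewrite -{1}(size_iota 0 K.+1) -prod_const_seq big_seq [leRHS]big_seq.
  apply: ler_prod => l; rewrite mem_iota add0n ltnS => /andP[_ lK].
  rewrite mulr_ge0 //=; apply: le_trans (cabsB_ge _ _); rewrite zK cabs_nat.
  have : (l%:R : R) <= K%:R by rewrite ler_nat.
  by move: (K%:R : R) (l%:R : R) => x y; lra.
have := cauchy_half (z := s) _ HS; have K70 : 0 <= 7 * K%:R :> R by rewrite mulr_ge0.
move=> /(_ K70) HSs.
have {}HSs : cabs S.[s] <= 2 * (5 * X / (6 * K%:R) ^+ K.+1).
  by apply: HSs; apply: le_trans sK _; move: K0'; move: (K%:R : R) => x; lra.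
have : cabs W.[s] = 1 by rewrite WE Qs0 mul0r sub0r cabsN cabs1.
apply/eqP; rewrite lt_eqF // ES hornerM cabsM.
apply: le_lt_trans (_ : 2 * (5 * X / (6 * K%:R) ^+ K.+1) * (2 * K%:R) ^+ K.+1 < 1).
  apply: ler_pM; rewrite ?cabs_ge0 // horner_prodXsubC big_map cabs_prod.
  rewrite -{2}(size_iota 0 K.+1) -prod_const_seq big_seq [leRHS]big_seq.
  apply: ler_prod => l; rewrite mem_iota add0n ltnS => /andP[_ lK]; rewrite cabs_ge0 /=.
  apply: le_trans (cabsB _ _) _; rewrite cabs_nat.
  have : (l%:R : R) <= K%:R by rewrite ler_nat.
  by move: sK; move: (K%:R : R) (l%:R : R) (cabs s) => x y u; lra.
have -> : 2 * (5 * X / (6 * K%:R) ^+ K.+1) * (2 * K%:R) ^+ K.+1 = 10 * X / 3 ^+ K.+1.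
  have -> : (6 * K%:R) ^+ K.+1 = 3 ^+ K.+1 * (2 * K%:R) ^+ K.+1 :> R.
    by rewrite -exprMn; congr (_ ^+ _); ring.
  have : (2 * K%:R) ^+ K.+1 != 0 :> R by rewrite expf_neq0 // mulf_neq0 ?gt_eqF.
  have : 3 ^+ K.+1 != 0 :> R by rewrite expf_neq0.
  by move: (_ ^+ _) (_ ^+ _) => u v u0 v0; field; rewrite u0 v0.
by rewrite ltr_pdivrMr ?mul1r ?exprn_gt0.
Qed.

Lemma psum_sqr (us : seq C) m : psum [seq u ^+ 2 | u <- us] m = psum us (2 * m).
Proof. by rewrite /psum big_map; apply: eq_bigr => u _; rewrite exprM. Qed.

(* Around its center a polynomial without small roots is nearly an exponential,
   so the values at [-1], [0], [1] are nearly in geometric progression. *)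
Lemma nearly_geometric Q (r M : R) : 0 < r -> 0 <= M ->
    Q.[0] != 0 ->
    (forall z, cabs z < 2 * r -> Q.[z] != 0) ->
    (forall z, cabs z = r -> cabs Q.[z] <= cabs Q.[0] * expR M) ->
    (r ^+ 2)^-1 * (1 + 4 * M) <= 2^-1 ->
  cabs (Q.[1] * Q.[-1] / Q.[0] ^+ 2 - 1) <= 2 * ((r ^+ 2)^-1 * (1 + 4 * M)).
Proof.
move=> r0 M0 Q0 HQ HQb small.
have [ts Ets] := closed_field_poly_normal Q.
have lQ : lead_coef Q != 0.
  by rewrite lead_coef_eq0; apply: contraNneq Q0 => ->; rewrite horner0.
have ts_far t : t \in ts -> 2 * r <= cabs t.
  move=> tts; rewrite leNgt; apply/negP => /HQ; rewrite Ets hornerZ mulf_eq0 negb_or.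
  by rewrite -rootE root_prod_XsubC tts andbF.
have ts0 t : t \in ts -> t != 0.
  by move=> /ts_far H; rewrite -cabs_gt0; apply: lt_le_trans H; rewrite mulr_gt0.
pose us := [seq t^-1 | t <- ts].
have QE z : Q.[z] = Q.[0] * rprod us z.
  rewrite Ets !hornerZ -mulrA; congr (_ * _).
  rewrite !horner_prodXsubC /rprod big_map -big_split /= big_seq [RHS]big_seq.
  by apply: eq_bigr => t /ts0 t0; field.
have usr u : u \in us -> cabs u * r <= 2^-1.
  move=> /mapP[t /ts_far tf ->].
  have t0 : 0 < cabs t by apply: lt_le_trans tf; rewrite mulr_gt0.
  by rewrite cabsV mulrC ler_pdivrMr //; move: tf; move: (cabs t) => y; lra.
have HE z : cabs z = r -> cabs (rprod us z) <= expR M.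
  move=> /HQb; rewrite QE cabsM ler_pM2l ?cabs_gt0 //.
(* Multiplying the values at 1 and -1 cancels the linear term of the logarithm: only the squares u^2
   remain, and their m-th power sum is the one of order 2 m of the u. *)
have -> : Q.[1] * Q.[-1] / Q.[0] ^+ 2 = rprod [seq u ^+ 2 | u <- us] 1.
  have -> : rprod [seq u ^+ 2 | u <- us] 1 = rprod us 1 * rprod us (-1).
    by rewrite /rprod big_map -big_split; apply: eq_bigr => u _ /=; ring.
  by rewrite (QE 1) (QE (-1)); field.
have -> : 4 * M = 2 * (2 * M) by ring.
apply: rprod1_near1; rewrite ?mulr_ge0 ?invr_ge0 ?exprn_ge0 ?(ltW r0) //.
  move=> m m0; rewrite psum_sqr.
  have := psum_bound (m := (2 * m)%N) r0 _ usr HE; rewrite muln_gt0 m0 => /(_ isT).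
  have -> : r ^+ (2 * m) = (r ^+ 2) ^+ m by rewrite exprM.
  rewrite exprVn -ler_pdivlMr ?exprn_gt0 // natrM => /le_trans; apply.
  by rewrite le_eqVlt; apply/orP; left; apply/eqP; ring.
by move: small; congr (_ <= _); ring.
Qed.

(** Recentred at m + 1 <= K / 2, the zero-free disk of radius K contains |z| < K / 2. The growth
    exponent is bounded crudely by K, and K / r^2 with r = K / 4 is already of order 1 / K; K >= 160
    meets the smallness condition of [nearly_geometric]. *)
Lemma interp_geometric a Q K (T : R) m : (160 <= K)%N -> (2 * m.+1 <= K)%N ->
    (forall n, cabs (a n) = 1) ->
    (forall n, (n <= K)%N -> Q.[n%:R] = a n) ->
    (forall s, cabs s <= 7 * K%:R -> cabs Q.[s] <= 2 * expR T) ->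
    0 <= T -> T <= K.+1%:R / 10 + 2^-1 ->
  cabs (a m.+2 * a m / a m.+1 ^+ 2 - 1) <= 160 / K%:R.
Proof.
move=> K160 mK a1 HQ HQb T0 HT.
have K0 : (0 < K)%N by apply: leq_trans K160.
have K0' : (0 : R) < K%:R by rewrite ltr0n.
have K160' : (160 : R) <= K%:R by rewrite ler_nat.
(* As 2 T <= (K + 1) / 5 + 1, e^(1/5) <= 3/2 and e <= 4, the left side is at most 40 (3/2)^(K+1),
   and 40 < 2^(K+1). *)
have HT2 : 10 * expR (2 * T) < 3 ^+ K.+1.
  have e1 : expR (2^-1) <= 2 :> R.
    have := expR_ge1Dx (- 2^-1 : R); rewrite expRN.
    have : 0 < expR (2^-1) :> R by apply: expR_gt0.
    move: (expR _) => x x0 H; have : 1 - 2^-1 <= x^-1 by [].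
    by rewrite -[x^-1]mul1r ler_pdivlMr //; lra.
  have e2 : expR (5^-1) <= 3 / 2 :> R.
    have := expR_ge1Dx (- 5^-1 : R); rewrite expRN.
    have : 0 < expR (5^-1) :> R by apply: expR_gt0.
    move: (expR _) => x x0 H; have : 1 - 5^-1 <= x^-1 by [].
    by rewrite -[x^-1]mul1r ler_pdivlMr //; lra.
  apply: le_lt_trans (_ : 10 * (expR 5^-1 ^+ K.+1 * (expR 2^-1 * expR 2^-1)) < _).
    rewrite ler_wpM2l // -expRM_natl -!expRD ler_expR.
    by move: HT; move: (K.+1%:R : R) => x; lra.
  apply: le_lt_trans (_ : 10 * ((3 / 2) ^+ K.+1 * (2 * 2)) < _).
    rewrite ler_wpM2l // ler_pM ?exprn_ge0 ?mulr_ge0 ?expR_ge0 //.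
      by rewrite lerXn2r ?nnegrE ?expR_ge0.
    by rewrite ler_pM ?expR_ge0.
  have -> : (3 : R) ^+ K.+1 = (3 / 2) ^+ K.+1 * 2 ^+ K.+1.
    by rewrite -exprMn divfK.
  have : 40 < 2 ^+ K.+1 :> R.
    rewrite -natrX ltr_nat; apply: leq_ltn_trans (ltn_expl _ (ltnSn 1)).
    by move: K160; clear; lia.
  have : 0 < (3 / 2) ^+ K.+1 :> R by rewrite exprn_gt0.
  by move: (_ ^+ _) (_ ^+ _) => x y x0 y40; nra.
have Q1 n : (n <= K)%N -> cabs Q.[n%:R] = 1 by move=> nK; rewrite HQ.
have Qn0 := unimodular_interp_neq0 K0 Q1 HQb T0 HT2.
pose c : C := m.+1%:R.
have cK : cabs c <= K%:R / 2.
  by rewrite cabs_nat ler_pdivlMr // mulrC -natrM ler_nat.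
pose Qs := Q \Po ('X + c%:P).
have QsE z : Qs.[z] = Q.[z + c] by rewrite horner_comp hornerD hornerX hornerC.
have Qs0 : Qs.[0] = a m.+1.
  rewrite QsE add0r HQ //; lia.
have Qsp : Qs.[1] = a m.+2.
  by rewrite QsE /c nat1r HQ //; lia.
have Qsm : Qs.[-1] = a m.
  rewrite QsE /c -(nat1r m) addKr HQ //; lia.
pose r : R := K%:R / 4.
have r0 : 0 < r by rewrite divr_gt0.
have HM : T + 1 <= K%:R.
  by move: HT K160'; rewrite -nat1r; move: (K%:R : R) => x; lra.
have := @nearly_geometric Qs r K%:R r0 (ltW K0').
rewrite Qs0 Qsp Qsm a1 mul1r -cabs_gt0 a1 => /(_ ltr01).
have yE : (r ^+ 2)^-1 * (1 + 4 * K%:R) <= 80 / K%:R.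
  have -> : (r ^+ 2)^-1 * (1 + 4 * K%:R) = 16 * (1 + 4 * K%:R) / K%:R / K%:R.
    by rewrite /r; field; rewrite gt_eqF.
  rewrite ler_wpM2r ?invr_ge0 // ler_pdivrMr //.
  by move: K160'; move: (K%:R : R) => x; lra.
have -> : 160 / K%:R = 2 * (80 / K%:R) :> R by ring.
move=> H; apply: le_trans (H _ _ _) _.
- move=> z zr; rewrite QsE Qn0 //; apply: le_trans (cabsD _ _) _.
  by move: zr cK; rewrite /r; move: (K%:R : R) => x; lra.
- move=> z zr; rewrite QsE; apply: le_trans (HQb _ _) _.
    apply: le_trans (cabsD _ _) _; rewrite zr /r.
    by move: cK K0'; move: (K%:R : R) => x; lra.
  apply: le_trans (_ : expR 1 * expR T <= _).
    rewrite ler_wpM2r ?expR_ge0 //; apply: le_trans (expR_ge1Dx _); lra.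
  by rewrite -expRD ler_expR addrC.
- apply: le_trans yE _; rewrite ler_pdivrMr //.
  by move: K160'; move: (K%:R : R) => x; lra.
by rewrite ler_wpM2l.
Qed.

End Interpolation.

(** * Complex limits along filters and ultrafilters *)

Section ComplexLimits.
Variable R : realType.
Local Notation C := R[i].
Implicit Types (T : Type).

Lemma gt0_complex (e : C) : 0 < e -> 0 < Re e /\ e = (Re e)%:C%C.
Proof.
by case: e => a b; rewrite ltcE /= => /andP[/eqP -> a0].
Qed.

Lemma cvg_cabsP T (F : set_system T) (FF : Filter F) (u : T -> Cplx R) (l : Cplx R) :
  u @ F --> l <-> forall e : R, 0 < e -> \forall t \near F, cabs (l - u t) < e.
Proof.
split=> [/cvgrPdist_lt H e e0|H].
  have e0' : 0 < e%:C%C :> Cplx R by rewrite ltcR.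
  by have := H _ e0'; apply: filterS => t; rewrite normE ltcR.
apply/cvgrPdist_lt => e /gt0_complex[e0 ->].
by have := H _ e0; apply: filterS => t; rewrite normE ltcR.
Qed.

Lemma cvg_ReIm T (F : set_system T) (FF : Filter F) (u : T -> Cplx R) (a b : R) :
  (fun t => Re (u t)) @ F --> a -> (fun t => Im (u t)) @ F --> b ->
  u @ F --> ((a +i* b)%C : Cplx R).
Proof.
move=> /cvgrPdist_lt Ha /cvgrPdist_lt Hb; apply/cvg_cabsP => e e0.
have e20 : 0 < e / 2 by rewrite divr_gt0.
apply: (filterS _ (filterI (Ha _ e20) (Hb _ e20))) => t [h1 h2].
apply: le_lt_trans (cabs_le_ReIm _) _; rewrite [e]splitr.
by case: (u t) h1 h2 => x y /= h1 h2; rewrite ltrD.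
Qed.

Lemma cvg_cabs_le T (F : set_system T) (FF : ProperFilter F) (u : T -> Cplx R)
  (l : Cplx R) (M : R) :
  u @ F --> l -> (\forall t \near F, cabs (u t) <= M) -> cabs l <= M.
Proof.
move=> /cvg_cabsP ul uM; apply/ler_addgt0Pr => e e0.
have [t [h1 h2]] := filter_ex (filterI (ul _ e0) uM).
by rewrite -(subrK (u t) l) addrC; apply: le_trans (cabsD _ _) _; rewrite lerD // ltW.
Qed.

(** Along an ultrafilter infinitely many bounded sequences converge at once, without a diagonal
    extraction. *)
Lemma cvg_ultra_bounded T (U : set_system T) (UU : UltraFilter U) (u : T -> R) (M : R) :
  (\forall t \near U, `|u t| <= M) -> exists l : R, u @ U --> l.
Proof.
move=> uM; have UA : (u @ U) `[- M, M]%classic.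
  by apply: filterS uM => t; rewrite /= in_itv /= ler_norml.
have [p [_ pcl]] := @segment_compact R (- M) M (u @ U) _ UA.
exists p => V pV; have [//|UV] := in_ultra_setVsetC (u @^-1` V) UU.
have [y []] := pcl (~` V) V UV pV.
by [].
Qed.

Lemma cvg_ultra_cabs_bounded T (U : set_system T) (UU : UltraFilter U)
    (u : T -> Cplx R) (M : R) :
  (\forall t \near U, cabs (u t) <= M) -> exists l : Cplx R, u @ U --> l.
Proof.
move=> uM.
have [|a ua] := @cvg_ultra_bounded _ U UU (fun t => Re (u t)) M.
  by apply: filterS uM => t; apply: le_trans (Re_le_cabs _).
have [|b ub] := @cvg_ultra_bounded _ U UU (fun t => Im (u t)) M.
  by apply: filterS uM => t; apply: le_trans (Im_le_cabs _).
by exists (a +i* b)%C; apply: cvg_ReIm.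
Qed.

End ComplexLimits.

(** * Entire power series given by their coefficients *)

Section PowerSeries.
Variable R : realType.
Local Notation C := R[i].
Implicit Types (c s : nat -> C) (x z w : C).

(** Equivalent to an infinite radius of convergence, in a form that a uniform bound transfers to
    limits of the coefficients. *)
Definition entire_coef c :=
  forall r : R, 0 <= r -> exists M, forall n, cabs (c n) * r ^+ n <= M.

Definition pser c z : Cplx R := limn (series (fun n => c n * z ^+ n : Cplx R)).

Lemma entire_coef_summable c (r : R) (p : nat) : entire_coef c -> 0 <= r ->
  exists K, forall N, \sum_(n < N) (n.+1 ^ p)%:R * (cabs (c n) * r ^+ n) <= K.
Proof.
(* At radius 2^(p+1) r, a factor 2^(p n) absorbs (n + 1)^p up to 2^p, and the remaining 2^n yields a
   geometric series. *)
move=> cE r0; have q0 : 0 <= 2 ^+ p.+1 * r by rewrite mulr_ge0 // exprn_ge0.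
have [M HM] := cE _ q0; exists (2 ^+ p * M * 2) => N.
have M0 : 0 <= M by apply: le_trans (HM 0%N); rewrite expr0 mulr1 cabs_ge0.
apply: le_trans (_ : \sum_(n < N) (2 ^+ p * M) * 2^-1 ^+ n <= _); last first.
  by rewrite -mulr_sumr ler_wpM2l ?sum_half_le // mulr_ge0 // exprn_ge0.
apply: ler_sum => n _.
apply: le_trans (_ : 2 ^+ p * 2^-1 ^+ n * (cabs (c n) * (2 ^+ p.+1 * r) ^+ n) <= _); last first.
  by rewrite mulrAC ler_wpM2r ?exprn_ge0 ?invr_ge0 // ler_wpM2l ?exprn_ge0.
rewrite exprMn mulrCA mulrA [leRHS]mulrA [leRHS]mulrC [in leRHS]mulrA.
rewrite [leRHS](_ : _ = (2 ^+ p * 2^-1 ^+ n * (2 ^+ p.+1) ^+ n) * (cabs (c n) * r ^+ n));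
  last by ring.
rewrite [leLHS](_ : _ = (n.+1 ^ p)%:R * (cabs (c n) * r ^+ n)); last by ring.
rewrite ler_wpM2r ?mulr_ge0 ?cabs_ge0 ?exprn_ge0 //.
have -> : 2 ^+ p * 2^-1 ^+ n * (2 ^+ p.+1) ^+ n = (2 ^ n.+1)%:R ^+ p :> R.
  rewrite natrX exprVn -!exprM !mulSn !exprD mulnC.
  by field; rewrite expf_neq0.
by rewrite natrX lerXn2r ?nnegrE // ler_nat ltnW // ltn_expl.
Qed.

End PowerSeries.

(** * Derivatives and zero counts of power series *)

Section PowerSeriesZeros.
Variable R : realType.
Local Notation C := R[i].
Implicit Types (c s : nat -> C) (x z w : C).

Lemma abs_series_cvg (u : nat -> R) (K : R) :
  (forall N, \sum_(n < N) `|u n| <= K) -> cvgn (series u).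
Proof.
move=> uK; apply: (@normed_cvg R R^o).
apply: nondecreasing_is_cvgn.
  by apply: nondecreasing_series => n _ _; apply: normr_ge0.
by exists K => _ [N _ <-]; have := uK N; rewrite -(big_mkord xpredT (fun n => `|u n|)).
Qed.

Lemma cvg_pser c z : entire_coef c ->
  (series (fun n => c n * z ^+ n : Cplx R) : nat -> Cplx R) @ \oo --> pser c z.
Proof.
move=> cE; have [K HK] := entire_coef_summable 0 cE (cabs_ge0 z).
have {}HK N : \sum_(n < N) cabs (c n * z ^+ n) <= K.
  by apply: le_trans (HK N); apply: ler_sum => n _; rewrite expn0 mul1r cabsM cabsX.
have /cvg_ex[/= a ca] : cvgn (series (fun n => Re (c n * z ^+ n))).
  apply: (@abs_series_cvg _ K) => N; apply: le_trans (HK N).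
  by apply: ler_sum => n _; apply: Re_le_cabs.
have /cvg_ex[/= b cb] : cvgn (series (fun n => Im (c n * z ^+ n))).
  apply: (@abs_series_cvg _ K) => N; apply: le_trans (HK N).
  by apply: ler_sum => n _; apply: Im_le_cabs.
have H : series (fun n => c n * z ^+ n : Cplx R) @ \oo --> ((a +i* b)%C : Cplx R).
  apply: cvg_ReIm.
    rewrite (_ : (fun _ => _) = series (fun n => Re (c n * z ^+ n))) //.
    by apply/funext => N; rewrite /series /= Re_sum.
  rewrite (_ : (fun _ => _) = series (fun n => Im (c n * z ^+ n))) //.
  by apply/funext => N; rewrite /series /= Im_sum.
by rewrite /pser (cvg_lim (@norm_hausdorff _ (Cplx R)) H).
Qed.

Lemma pserE c z (l : Cplx R) :
  (series (fun n => c n * z ^+ n : Cplx R) : nat -> Cplx R) @ \oo --> l -> pser c z = l.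
Proof. exact: (cvg_lim (@norm_hausdorff _ (Cplx R))). Qed.

(** Multiplication by z - x on coefficient sequences: zeros are exhibited as factors, so no division
    of power series occurs. *)
Definition mulXsub x c n : C := (if n is n'.+1 then c n' else 0) - x * c n.

Lemma entire_mulXsub x c : entire_coef c -> entire_coef (mulXsub x c).
Proof.
move=> cE r r0; have [M HM] := cE r r0.
have M0 : 0 <= M by apply: le_trans (HM 0%N); rewrite expr0 mulr1 cabs_ge0.
exists (r * M + cabs x * M) => n;
  apply: le_trans (_ : (cabs (if n is n'.+1 then c n' else 0) + cabs x * cabs (c n)) * r ^+ n <= _).
  by rewrite ler_wpM2r ?exprn_ge0 // -cabsM cabsB.
rewrite mulrDl lerD //; last by rewrite -mulrA ler_wpM2l ?cabs_ge0.
case: n => [|n]; first by rewrite cabs0 mul0r mulr_ge0.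
by rewrite exprS mulrCA ler_wpM2l.
Qed.

Lemma pser_mulXsub x c z : entire_coef c ->
  pser (mulXsub x c) z = (z - x) * pser c z.
Proof.
move=> cE; apply: pserE; have H := @cvg_pser _ z cE.
rewrite -cvg_shiftS.
have HS := H; rewrite -cvg_shiftS in HS.
rewrite mulrBl; pose S := series (fun n => c n * z ^+ n : Cplx R).
rewrite (_ : (fun n => _) = (fun N => z * S N - x * S N.+1)).
  exact: cvgB (cvgM (cvg_cst (z : Cplx R)) H) (cvgM (cvg_cst (x : Cplx R)) HS).
rewrite /S; apply/funext => N; rewrite /series /= !big_mkord.
under eq_bigr do rewrite /mulXsub mulrBl.
rewrite sumrB; congr (_ - _); last by rewrite mulr_sumr; apply: eq_bigr => n _; rewrite mulrA.
by rewrite big_ord_recl mul0r add0r mulr_sumr; apply: eq_bigr => n _; rewrite lift0 exprS; ring.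
Qed.

Definition dcoef c n : C := n.+1%:R * c n.+1.

Lemma entire_dcoef c : entire_coef c -> entire_coef (dcoef c).
Proof.
move=> cE r r0; have r1 : 0 <= r + 1 by rewrite addr_ge0.
have [K HK] := entire_coef_summable 1 cE r1; exists K => n.
apply: le_trans (HK n.+2); rewrite big_ord_recr /= expn1 cabsM cabs_nat.
apply: ler_wpDl.
  by apply: sumr_ge0 => i _; rewrite !mulr_ge0 ?cabs_ge0 ?exprn_ge0.
rewrite -mulrA ler_pM ?mulr_ge0 ?cabs_ge0 ?exprn_ge0 ?ler_nat //.
rewrite ler_wpM2l ?cabs_ge0 //; apply: le_trans (_ : (r + 1) ^+ n <= _).
  by rewrite lerXn2r ?nnegrE // lerDl.
by rewrite exprS ler_peMl ?exprn_ge0 // lerDr.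
Qed.

Lemma expr_second_diff z h (r : R) n : 1 <= r -> cabs z <= r -> cabs (z + h) <= r ->
  cabs ((z + h) ^+ n - z ^+ n - h * (n%:R * z ^+ n.-1)) <= cabs h ^+ 2 * ((n ^ 2)%:R * r ^+ n).
Proof.
move=> r1 zr zhr; have r0 : 0 <= r by apply: le_trans zr; apply: cabs_ge0.
have rX m : r ^+ m <= r ^+ m.+1 by rewrite exprS ler_peMl ?exprn_ge0.
have D1 m : cabs ((z + h) ^+ m - z ^+ m) <= cabs h * (m%:R * r ^+ m).
  elim: m => [|m IH]; first by rewrite !expr0 subrr cabs0 !mul0r mulr0.
  have -> : (z + h) ^+ m.+1 - z ^+ m.+1 = (z + h) * ((z + h) ^+ m - z ^+ m) + h * z ^+ m.
    by rewrite !exprS; ring.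
  apply: le_trans (cabsD _ _) _; rewrite 2!cabsM cabsX.
  apply: le_trans (_ : r * (cabs h * (m%:R * r ^+ m)) + cabs h * r ^+ m.+1 <= _).
    rewrite lerD //; first by rewrite ler_pM ?cabs_ge0.
    rewrite ler_wpM2l ?cabs_ge0 //; apply: le_trans (rX m).
    by rewrite lerXn2r ?nnegrE ?cabs_ge0.
  by rewrite -nat1r le_eqVlt; apply/orP; left; apply/eqP; rewrite exprS; ring.
elim: n => [|n IH].
  by rewrite !expr0 subrr !mul0r mulr0 subr0 cabs0 mulr0.
have -> : (z + h) ^+ n.+1 - z ^+ n.+1 - h * (n.+1%:R * z ^+ n.+1.-1) =
   z * ((z + h) ^+ n - z ^+ n - h * (n%:R * z ^+ n.-1)) + h * ((z + h) ^+ n - z ^+ n).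
  rewrite -nat1r /= !exprS; case: n {IH} => [|n] /=; first by rewrite !expr0; ring.
  by rewrite !exprS; ring.
apply: le_trans (cabsD _ _) _; rewrite 2!cabsM.
apply: le_trans (_ : r * (cabs h ^+ 2 * ((n ^ 2)%:R * r ^+ n)) + cabs h * (cabs h * (n%:R * r ^+ n.+1)) <= _).
  rewrite lerD // ler_pM ?cabs_ge0 //; apply: le_trans (D1 n) _.
  by rewrite ler_wpM2l ?cabs_ge0 // ler_wpM2l.
have -> : r * (cabs h ^+ 2 * ((n ^ 2)%:R * r ^+ n)) + cabs h * (cabs h * (n%:R * r ^+ n.+1)) = cabs h ^+ 2 * ((n ^ 2 + n)%:R * r ^+ n.+1).
  by rewrite (natrD _ (n ^ 2)%N n) !natrX [r ^+ n.+1]exprS; ring.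
rewrite ler_wpM2l ?exprn_ge0 ?cabs_ge0 // ler_wpM2r ?exprn_ge0 // ler_nat; lia.
Qed.

Lemma pser_second_diff c z : entire_coef c -> exists2 K : R, 0 <= K &
  forall h, cabs h <= 1 ->
    cabs (pser c (z + h) - pser c z - h * pser (dcoef c) z) <= cabs h ^+ 2 * K.
Proof.
move=> cE; pose r := cabs z + 1.
have r1 : 1 <= r by rewrite lerDr cabs_ge0.
have r0 : 0 <= r by apply: le_trans r1.
have [K HK] := entire_coef_summable 2 cE r0; exists K.
  by apply: le_trans (HK 0%N); rewrite big_ord0.
move=> h h1; have H1 := @cvg_pser _ (z + h) cE; have H2 := @cvg_pser _ z cE.
have H3 := @cvg_pser _ z (entire_dcoef cE).
rewrite -cvg_shiftS in H1; rewrite -cvg_shiftS in H2.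
(* The third sum stops one term earlier because [dcoef] shifts the index. *)
pose u N : Cplx R := series (fun n => c n * (z + h) ^+ n : Cplx R) N.+1
  - series (fun n => c n * z ^+ n : Cplx R) N.+1
  - h * series (fun n => dcoef c n * z ^+ n : Cplx R) N.
have H : u @ \oo --> (pser c (z + h) - pser c z - h * pser (dcoef c) z : Cplx R).
  exact: cvgB (cvgB H1 H2) (cvgM (cvg_cst (h : Cplx R)) H3).
apply: (cvg_cabs_le _ H); apply: nearW => N; rewrite /u.
rewrite -[X in cabs X](_ : \sum_(n < N.+1) c n * ((z + h) ^+ n - z ^+ n - h * (n%:R * z ^+ n.-1)) = _); last first.
  under eq_bigr => n _ do rewrite 2!mulrBr.
  rewrite !sumrB /series /= !big_mkord; congr (_ - _).
  rewrite big_ord_recl !mul0r !mulr0 add0r mulr_sumr; apply: eq_bigr => n _.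
  by rewrite lift0 /dcoef /=; ring.
apply: le_trans (cabs_sum _ _ _) _;
  apply: le_trans (_ : \sum_(n < N.+1) cabs h ^+ 2 * ((n.+1 ^ 2)%:R * (cabs (c n) * r ^+ n)) <= _); last first.
  by rewrite -mulr_sumr ler_wpM2l ?exprn_ge0 ?cabs_ge0.
apply: ler_sum => n _; rewrite cabsM.
have zr : cabs z <= r by rewrite lerDl.
have zhr : cabs (z + h) <= r by apply: le_trans (cabsD _ _) _; rewrite lerD2l.
apply: le_trans (_ : cabs (c n) * (cabs h ^+ 2 * ((n ^ 2)%:R * r ^+ n)) <= _).
  by rewrite ler_wpM2l ?cabs_ge0 // expr_second_diff.
rewrite mulrCA ler_wpM2l ?exprn_ge0 ?cabs_ge0 // mulrCA ler_wpM2r ?mulr_ge0 ?cabs_ge0 ?exprn_ge0 //.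
by rewrite ler_nat leq_exp2r.
Qed.

Lemma derive1_pser c : entire_coef c ->
  derive1 (pser c : Cplx R -> Cplx R) = (pser (dcoef c) : Cplx R -> Cplx R).
Proof.
move=> cE; apply/funext => z; have [K K0 HK] := pser_second_diff z cE.
apply: (cvg_lim (@norm_hausdorff _ (Cplx R))).
apply/cvg_cabsP => e e0.
have d0 : 0 < Num.min 1 (e / (K + 1)) by rewrite lt_min ltr01 divr_gt0 // ltr_wpDl.
have d0' : 0 < (Num.min 1 (e / (K + 1)))%:C%C :> Cplx R by rewrite ltcR.
have := @nbhsx_ballx _ (Cplx R) 0 _ d0'.
rewrite /dnbhs /within /=; apply: filterS => h;
  rewrite -ball_normE /= sub0r normrN normE ltcR lt_min.
move=> /andP[h1 he] hn0.
have h0 : 0 < cabs h by rewrite cabs_gt0.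
rewrite -(ltr_pM2l h0) -cabsM; apply: le_lt_trans (_ : cabs h ^+ 2 * K < _).
  have -> : h * (pser (dcoef c) z - h^-1 *: (pser c (h + z) - pser c z)) = - (pser c (z + h) - pser c z - h * pser (dcoef c) z).
    by rewrite -[_ *: _]/(h^-1 * _) mulrBr mulrA divff // mul1r [h + z]addrC; ring.
  by rewrite cabsN HK // ltW.
rewrite expr2 -mulrA ltr_pM2l //.
have K10 : 0 < K + 1 by rewrite ltr_wpDl.
move: he; rewrite ltr_pdivlMr // => he.
by apply: le_lt_trans he; rewrite ler_wpM2l ?cabs_ge0 // lerDl.
Qed.

Lemma derive1n_pser c j : entire_coef c ->
  entire_coef (iter j dcoef c) /\
  derive1n j (pser c : Cplx R -> Cplx R) = (pser (iter j dcoef c) : Cplx R -> Cplx R).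
Proof.
move=> cE; elim: j => [|j [IH1 IH2]]; first by [].
split; first exact: entire_dcoef.
by rewrite /derive1n iterS -/(derive1n j _) IH2 derive1_pser.
Qed.

Lemma dcoef_mulXsub x s : dcoef (mulXsub x s) = (fun n => s n + mulXsub x (dcoef s) n).
Proof.
apply/funext => -[|n]; rewrite /dcoef /mulXsub; first by ring.
by rewrite -(nat1r n.+1); ring.
Qed.

Lemma mulXsubD x s t : mulXsub x (fun n => s n + t n) = (fun n => mulXsub x s n + mulXsub x t n).
Proof. by apply/funext => -[|n]; rewrite /mulXsub; ring. Qed.

Lemma entire_add s t : entire_coef s -> entire_coef t -> entire_coef (fun n => s n + t n).
Proof.
move=> sE tE r r0; have [M HM] := sE r r0; have [M' HM'] := tE r r0; exists (M + M') => n.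
by apply: le_trans (lerD (HM n) (HM' n)); rewrite -mulrDl ler_wpM2r ?exprn_ge0 ?cabsD.
Qed.

Lemma entire_iter_mulXsub x k s : entire_coef s -> entire_coef (iter k (mulXsub x) s).
Proof. by move=> sE; elim: k => //= k IH; apply: entire_mulXsub. Qed.

(** Leibniz: differentiation removes at most one factor z - x. *)
Lemma dcoef_iter_mulXsub x k s : entire_coef s -> exists2 s', entire_coef s' &
  dcoef (iter k.+1 (mulXsub x) s) = iter k (mulXsub x) s'.
Proof.
move=> sE; elim: k => [|k [s' s'E IH]].
  exists (fun n => s n + mulXsub x (dcoef s) n); last by rewrite /= dcoef_mulXsub.
  by apply: entire_add => //; apply/entire_mulXsub/entire_dcoef.
exists (fun n => s n + s' n); first exact: entire_add.
rewrite iterS dcoef_mulXsub IH.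
have -> u v m : iter m (mulXsub x) (fun n => u n + v n) = (fun n => iter m (mulXsub x) u n + iter m (mulXsub x) v n).
  by elim: m => // m IHm; rewrite iterS IHm mulXsubD.
by [].
Qed.

(** A lower bound on multiplicities suffices, since it will contradict an upper bound on their
    sum. *)
Lemma zero_mult_ge x k s : entire_coef s ->
  (k%:R%:E <= zero_mult (pser (iter k (mulXsub x) s) : Cplx R -> Cplx R) x)%E.
Proof.
move=> sE; apply: ereal_sup_ubound => /=; exists k => // j jk.
have [_ ->] := derive1n_pser j (entire_iter_mulXsub x k sE).
have [s' s'E ->] : exists2 s', entire_coef s' &
   iter j dcoef (iter k (mulXsub x) s) = iter (k - j) (mulXsub x) s'.
  elim: j jk => [|j IH] jk; first by exists s; rewrite ?subn0.
  have [s' s'E Es'] := IH (ltnW jk).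
  have [s'' s''E Es''] := dcoef_iter_mulXsub x (k - j.+1) s'E.
  by exists s'' => //; rewrite iterS Es' -(subnSK (ltnW jk)).
rewrite -(subnSK jk) iterS pser_mulXsub; first by rewrite subrr mul0r.
exact: entire_iter_mulXsub.
Qed.

Lemma mulXsubC x y s : mulXsub x (mulXsub y s) = mulXsub y (mulXsub x s).
Proof. by apply/funext => -[|[|n]]; rewrite /mulXsub; ring. Qed.

Lemma foldr_mulXsub_filter x xs s : foldr mulXsub s xs =
  iter (count_mem x xs) (mulXsub x) (foldr mulXsub s [seq y <- xs | y != x]).
Proof.
have comm y k t : mulXsub y (iter k (mulXsub x) t) = iter k (mulXsub x) (mulXsub y t).
  by elim: k => //= k IH; rewrite mulXsubC IH.
elim: xs => //= y xs IH; rewrite IH; case: eqVneq => [->|yx] /=; first by [].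
by rewrite comm.
Qed.

Lemma entire_foldr xs s : entire_coef s -> entire_coef (foldr mulXsub s xs).
Proof. by move=> sE; elim: xs => //= x xs; apply: entire_mulXsub. Qed.

Lemma zero_count_ge xs s (r : R) : entire_coef s -> all (fun x => cabs x <= r) xs ->
  ((size xs)%:R%:E <= zero_count (pser (foldr mulXsub s xs) : Cplx R -> Cplx R) r)%E.
Proof.
move=> sE xsr; set F := pser _.
apply: le_trans (_ : \sum_(x \in [set` undup xs]) zero_mult (F : Cplx R -> Cplx R) x <= _)%E;
  last first.
  apply: ereal_sup_ubound; exists [set` undup xs] => //; split; first exact: finite_seq.
  move=> x /=; rewrite mem_undup => xxs; split.
    by rewrite normE lecR; apply: (allP xsr).
  rewrite /F (foldr_mulXsub_filter x);
    have : (0 < count_mem x xs)%N by rewrite -has_count has_pred1.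
  case: (count_mem x xs) => // k _; rewrite iterS pser_mulXsub ?subrr ?mul0r //.
  by apply: entire_iter_mulXsub; apply: entire_foldr.
rewrite -fsbig_seq ?undup_uniq //.
apply: le_trans (_ : (\sum_(x <- undup xs) (count_mem x xs)%:R%:E <= _)%E); last first.
  apply: lee_sum => x _; rewrite /F (foldr_mulXsub_filter x).
  by apply: zero_mult_ge; apply: entire_foldr.
rewrite sumEFin lee_fin -natr_sum ler_nat.
have -> : size xs = (\sum_(x <- xs) 1)%N by rewrite sum1_size.
rewrite -big_undup_iterop_count leq_eqVlt; apply/orP; left; apply/eqP.
by apply: eq_bigr => x _; case: (count_mem x xs) => // k;
  rewrite Monoid.iteropE iter_addn_0 mul1n.
Qed.

End PowerSeriesZeros.

(** * Hurwitz's theorem by compactness *)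

Section Hurwitz.
Variable R : realType.
Local Notation C := R[i].
Implicit Types (c s : nat -> C) (x z w : C).

Lemma coef_prod_mulXsub (xs : seq C) (G : {poly C}) n :
  (\prod_(x <- xs) ('X - x%:P) * G)`_n = foldr (@mulXsub R) (fun n => G`_n) xs n.
Proof.
elim: xs n => [|x xs IH] n; first by rewrite big_nil mul1r.
rewrite big_cons -mulrA mulrBl coefB coefXM coefCM /= /mulXsub !IH.
by case: n => [|n] //=; rewrite IH.
Qed.

Lemma cvg_foldr_mulXsub (U : set_system nat) (FU : ProperFilter U) (I : Type) (l : seq I)
    (u : I -> nat -> Cplx R) (x : I -> Cplx R) (g : nat -> nat -> C) s :
    (forall i, u i @ U --> x i) ->
    (forall n, (fun N => g N n : Cplx R) @ U --> (s n : Cplx R)) ->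
  forall n, (fun N => foldr (@mulXsub R) (g N) [seq u i N | i <- l] n : Cplx R) @ U
    --> (foldr (@mulXsub R) s [seq x i | i <- l] n : Cplx R).
Proof.
move=> ux gs; have FF : Filter U by exact _.
elim: l => [|i l IH] n //=.
have H2 := @cvgM _ _ U FF _ _ _ _ (ux i) (IH n).
case: n H2 => [|n] H2.
  exact: (@cvgB _ _ _ U FF _ _ _ _ (cvg_cst (0 : Cplx R)) H2).
have H1 := IH n.
exact: (@cvgB _ _ _ U FF _ _ _ _ H1 H2).
Qed.

(** Roots and cofactor coefficients of the Taylor polynomials are bounded, so they converge along an
    ultrafilter containing the tails of [nat], and the factorisation passes to the limit coefficient
    by coefficient. *)
Lemma hurwitz c (r0 : R) k (Bd : R -> R) N0 : 0 <= r0 ->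
    (forall N z, cabs (\poly_(i < N.+1) c i).[z] <= Bd (cabs z)) ->
    (forall N, (N0 <= N)%N -> exists xs (G : {poly C}),
       [/\ size xs = k, all (fun x => cabs x <= r0) xs &
           \poly_(i < N.+1) c i = \prod_(x <- xs) ('X - x%:P) * G]) ->
  exists xs s, [/\ size xs = k, all (fun x => cabs x <= r0) xs, entire_coef s &
                   c = foldr (@mulXsub R) s xs].
Proof.
move=> r00 HB H.
have /choice[XG HXG] : forall N, exists XG : seq C * {poly C},
   [/\ size XG.1 = k, all (fun x => cabs x <= r0) XG.1 &
       \poly_(i < (N0 + N).+1) c i = \prod_(x <- XG.1) ('X - x%:P) * XG.2].
  by move=> N; have [xs [G HG]] := H _ (leq_addr N N0); exists (xs, G).
have [U [UU sU]] := @ultraFilterLemma nat \oo _.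
have /choice[x Hx] : forall i, exists x : Cplx R, (fun N => (XG N).1`_i : Cplx R) @ U --> x.
  move=> i; apply: (@cvg_ultra_cabs_bounded _ _ _ _ _ r0); apply: nearW => N.
  have [sz al _] := HXG N; have [ik|ik] := ltnP i (size (XG N).1).
    by apply: (allP al); apply: mem_nth.
  by rewrite nth_default // cabs0.
(* On |z| = r0 + 1 + r every |z - x| is at least 1, so the cofactor is no larger there than the
   polynomial. *)
have Gb N n (r : R) : 0 <= r -> cabs (XG N).2`_n * (r0 + 1 + r) ^+ n <= Bd (r0 + 1 + r).
  move=> rge0; have rho0 : 0 <= r0 + 1 + r by rewrite !addr_ge0.
  apply: cauchy_coef => // z zr; have [_ al E] := HXG N.
  rewrite -zr; apply: le_trans (HB (N0 + N)%N z); rewrite E hornerM cabsM ler_peMl ?cabs_ge0 //.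
  rewrite horner_prodXsubC cabs_prod big_seq; elim/big_rec: _ => // y p yX p1.
  rewrite -[leLHS]mulr1 ler_pM //; apply: le_trans (cabsB_ge _ _).
  by have := allP al _ yX; rewrite zr; lra.
have /choice[s Hs] : forall n, exists s : Cplx R, (fun N => (XG N).2`_n : Cplx R) @ U --> s.
  move=> n; apply: (@cvg_ultra_cabs_bounded _ _ _ _ _ (Bd (r0 + 1 + 0))); apply: nearW => N.
  apply: le_trans (Gb N n 0 (lexx _)); rewrite ler_peMr ?cabs_ge0 //.
  by rewrite exprn_ege1 // addr0 lerDr.
exists [seq x i | i <- iota 0 k], s; split.
- by rewrite size_map size_iota.
- apply/allP => _ /mapP[i + ->]; rewrite mem_iota /= add0n => ik.
  apply: (cvg_cabs_le _ (Hx i)); apply: nearW => N.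
  have [sz al _] := HXG N.
  by apply: (allP al); apply: mem_nth; rewrite sz.
- move=> r rge0; exists (Bd (r0 + 1 + r)) => n.
  have rho0 : 0 < (r0 + 1 + r) ^+ n by rewrite exprn_gt0 // -addrA ltr_wpDl // ltr_wpDr.
  apply: le_trans (_ : cabs (s n) * (r0 + 1 + r) ^+ n <= _).
    by rewrite ler_wpM2l ?cabs_ge0 // lerXn2r ?nnegrE ?addr_ge0 // lerDr addr_ge0.
  rewrite -ler_pdivlMr //; apply: (cvg_cabs_le _ (Hs n)); apply: nearW => N.
  by rewrite ler_pdivlMr // Gb.
apply/funext => n.
have PU : ProperFilter U by exact: ultra_proper.
have /cvg_cabsP HL := @cvg_foldr_mulXsub U PU nat (iota 0 k)
  (fun i N => (XG N).1`_i) x (fun N n => (XG N).2`_n) s Hx Hs n.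
apply/eqP; rewrite eq_sym -subr_eq0 -cabs_eq0 eq_le cabs_ge0 andbT.
apply/ler_addgt0Pr => e e0; rewrite add0r.
(* For N >= n the n-th Taylor coefficient is already [c n]. *)
have nU : U [set N | (n <= N)%N] by apply: sU; exists n.
have [N [h1 h2]] := filter_ex (filterI (HL e e0) nU).
have [sz _ E] := HXG N.
move: h1; have -> : [seq (XG N).1`_i | i <- iota 0 k] = (XG N).1.
  by rewrite -sz -/(mkseq _ _) mkseq_nth.
rewrite -coef_prod_mulXsub -E coef_poly ltnS (leq_trans h2 (leq_addl _ _)).
exact: ltW.
Qed.

(** Contrapositive of [hurwitz]: were there k + 1 roots in the disk for every N >= N0, the series
    would have as many zeros there. *)
Lemma few_roots_taylor c (r : R) k (Bd : R -> R) N0 : 0 <= r ->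
    (forall N z, cabs (\poly_(i < N.+1) c i).[z] <= Bd (cabs z)) ->
    c 0%N != 0 ->
    (zero_count (pser c : Cplx R -> Cplx R) r < k.+1%:R%:E)%E ->
  exists N xs ws a, [/\ (N0 <= N)%N, (size xs <= k)%N,
    \poly_(i < N.+1) c i = a *: (\prod_(x <- xs) ('X - x%:P) * \prod_(w <- ws) ('X - w%:P)),
    (forall x, x \in xs -> cabs x <= r) & (forall w, w \in ws -> r < cabs w)].
Proof.
move=> r0 HB c0 Hz; apply: contrapT => Hno.
have [N N0N|xs [s [sz al sE Ec]]] := @hurwitz c r k.+1 Bd N0 r0 HB; last first.
  by move: Hz; rewrite ltNge -sz Ec zero_count_ge.
have [rs Ers] := closed_field_poly_normal (\poly_(i < N.+1) c i).
pose xs := [seq x <- rs | cabs x <= r]; pose ws := [seq x <- rs | ~~ (cabs x <= r)].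
have Eall : \prod_(z <- rs) ('X - z%:P) = \prod_(x <- xs) ('X - x%:P) * \prod_(w <- ws) ('X - w%:P).
  by rewrite !big_filter [LHS](bigID (fun x : C => cabs x <= r)).
have kxs : (k < size xs)%N.
  rewrite ltnNge; apply/negP => xk; apply: Hno.
  exists N, xs, ws, (lead_coef (\poly_(i < N.+1) c i)); split => //.
  - by rewrite -Eall.
  - by move=> x; rewrite mem_filter => /andP[].
  - by move=> w; rewrite mem_filter -ltNge => /andP[].
(* [hurwitz] needs a fixed number of roots, so the surplus goes to the cofactor. *)
exists (take k.+1 xs), (lead_coef (\poly_(i < N.+1) c i) *: (\prod_(x <- drop k.+1 xs) ('X - x%:P) * \prod_(w <- ws) ('X - w%:P))); split.
- by rewrite size_takel.
- by apply/allP => x /mem_take; rewrite mem_filter => /andP[].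
rewrite -scalerAr mulrA -big_cat cat_take_drop -Eall; exact: Ers.
Qed.

End Hurwitz.

(** * Unimodular coefficients: from few zeros to a geometric progression *)

Section Unimodular.
Variable R : realType.
Local Notation C := R[i].
Implicit Types (om : nat -> C) (z w : C).

Lemma exp_partial_le (x : R) N : 0 <= x -> \sum_(n < N) x ^+ n / n`!%:R <= expR x.
Proof.
move=> x0; rewrite /expR -(big_mkord xpredT (fun n => x ^+ n / n`!%:R)).
have := @nondecreasing_cvgn_le R (series (exp_coeff x)) _ (is_cvg_series_exp_coeff x) N.
apply; apply: nondecreasing_series => n _ _; exact: exp_coeff_ge0.
Qed.

Lemma exp_partial_half (x : R) : exists N0, forall N, (N0 <= N)%N ->
  expR x / 2 <= \sum_(n < N) x ^+ n / n`!%:R.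
Proof.
have cv : series (exp_coeff x) @ \oo --> expR x by exact: is_cvg_series_exp_coeff.
have h : expR x / 2 < expR x by rewrite ltr_pdivrMr //; have := expR_gt0 x; lra.
have [N0 _ H] := cvgr_gt _ cv _ h.
exists N0 => N NN; have := H N NN; rewrite /= /series /= big_mkord; exact: ltW.
Qed.

Definition egf om n : C := om n / n`!%:R.

Lemma cabs_egf om n : (forall n, cabs (om n) = 1) -> cabs (egf om n) = (n`!%:R)^-1.
Proof. by move=> om1; rewrite cabsM om1 mul1r cabsV cabs_nat. Qed.

Lemma entire_egf om : (forall n, cabs (om n) = 1) -> entire_coef (egf om).
Proof.
move=> om1 r r0; exists (expR r) => n; apply: le_trans (exp_partial_le n.+1 r0).
rewrite big_ord_recr /= cabs_egf // mulrC lerDr; apply: sumr_ge0 => i _.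
by rewrite divr_ge0 // exprn_ge0.
Qed.

Lemma taylor_bound om N z : (forall n, cabs (om n) = 1) -> 
  cabs (\poly_(i < N.+1) egf om i).[z] <= expR (cabs z).
Proof.
move=> om1; rewrite horner_poly; apply: le_trans (cabs_sum _ _ _) _.
apply: le_trans (exp_partial_le N.+1 (cabs_ge0 z)); apply: ler_sum => n _.
by rewrite cabsM cabsX cabs_egf // mulrC.
Qed.

Lemma geometric_of_few_zeros om (r : R) K m (rho := r / (32 * 1000)) :
    (forall n, cabs (om n) = 1) -> 
    2 * 1000 * 1000 <= rho -> 16 * K%:R <= rho -> rho <= 16 * K.+1%:R ->
    (160 <= K)%N -> (2 * m.+1 <= K)%N ->
    (zero_count (pser (egf om) : Cplx R -> Cplx R) r < (zero_density R * r)%:E)%E ->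
  cabs (om m.+2 * om m / om m.+1 ^+ 2 - 1) <= 160 / K%:R.
Proof.
move=> om1 rho_ge rhoK rhoKS K160 mK Hz.
have r0 : 0 <= r by move: rho_ge; rewrite /rho; lra.
have rho0 : 0 < rho by apply: lt_le_trans rho_ge; clear; lra.
have Hz' : (zero_count (pser (egf om) : Cplx R ->
  Cplx R) r < (Num.truncn (zero_density R * r)).+1%:R%:E)%E.
  by apply: lt_trans Hz _; rewrite lte_fin truncnS_gt.
have [N0 HN0] := exp_partial_half (999 / 1000 * rho).
have c0 : egf om 0%N != 0 by rewrite -cabs_gt0 cabs_egf // invr_gt0 ltr0n fact_gt0.
(* The degree must reach [N0] for the lower growth bound, and [K] for the differences up to order
   [K]. *)
have [N [xs [ws [a [NN sxs EP Hx Hw]]]]] := few_roots_taylor (maxn N0 K) r0 (fun N z => taylor_bound N z om1) c0 Hz'.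
move: NN; rewrite geq_max => /andP[N0N KN].
set P := \poly_(i < N.+1) _ in EP.
have szP : size P = N.+1.
  by apply: size_poly_eq; rewrite -cabs_gt0 cabs_egf // invr_gt0 ltr0n fact_gt0.
have coP n : (n <= N)%N -> P`_n = egf om n by move=> nN; rewrite coef_poly ltnS nN.
have P0 : cabs P.[0] = 1 by rewrite horner_coef0 coP // cabs_egf // fact0 invr1.
have Hk : (size xs)%:R <= zero_density R * r.
  apply: le_trans (_ : (Num.truncn (zero_density R * r))%:R <= _); first by rewrite ler_nat.
  by rewrite truncn_le mulr_ge0 // ltW // zero_density_gt0.
have Hlow : expR (999 / 1000 * rho) / 2 <= \sum_(n < size P) cabs P`_n * (999 / 1000 * rho) ^+ n.
  rewrite szP; apply: le_trans (HN0 _ (leqW N0N)) _; apply: ler_sum => n _.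
  by rewrite coP ?cabs_egf 1?mulrC // -ltnS ltn_ord.
have [al al1 Hal] := exp_type_of_few_roots P0 (fun z => taylor_bound N z om1) EP Hx Hw Hk rho_ge Hlow.
(* The first term comes from [exp_type_of_few_roots], the 1/2 from [fdiff_bound]. *)
pose T := 6 / 1000 * rho + 2^-1.
pose b n := om n / al ^+ n.
have b1 n : cabs (b n) = 1 by rewrite cabsM om1 mul1r cabsV cabsX al1 expr1n invr1.
pose Q := newton_interp (fun j => iter j fdiff b 0%N) K.
have HQ n : (n <= K)%N -> Q.[n%:R] = b n by apply: newton_interpE.
have HQb s : cabs s <= 7 * K%:R -> cabs Q.[s] <= 2 * expR T.
  move=> sK; apply: (newton_interp_bound rho0 (expR_ge0 _)); last first.
    by move: sK rhoK; clear; move: (K%:R : R) (cabs s) => x y; lra.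
  move=> j jK; apply: (@fdiff_bound _ om P al rho _ N) => //; first exact: ltW.
  exact: leq_trans jK KN.
have T0 : 0 <= T by rewrite /T; clear -rho0; lra.
have HT : T <= K.+1%:R / 10 + 2^-1.
  have : (0 : R) <= K.+1%:R by [].
  by move: rhoKS; rewrite /T; clear; move: (K.+1%:R : R) => x; lra.
have := interp_geometric K160 mK b1 HQ HQb T0 HT.
have al0 : al != 0 by rewrite -cabs_gt0 al1.
have om0 n : om n != 0 by rewrite -cabs_gt0 om1.
have -> // : b m.+2 * b m / b m.+1 ^+ 2 = om m.+2 * om m / om m.+1 ^+ 2.
by rewrite /b !exprS; field; rewrite om0 al0 expf_neq0.
Qed.

(** For fixed [m] the ratio is within 160 / K of 1 for arbitrarily large K, hence equal to 1. *)
Lemma exponential_of_frequently_few_zeros om :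
    (forall n, cabs (om n) = 1) -> 
    (forall A : R, exists2 r, A <= r &
       (zero_count (pser (egf om) : Cplx R -> Cplx R) r < (zero_density R * r)%:E)%E) ->
  forall n, om n = om 0%N * (om 1%N / om 0%N) ^+ n.
Proof.
move=> om1 H.
have om0 n : om n != 0 by rewrite -cabs_gt0 om1.
have geo m : om m.+2 * om m = om m.+1 ^+ 2.
  have H0 : cabs (om m.+2 * om m / om m.+1 ^+ 2 - 1) <= 0.
    apply: (@le_limit_inv R _ 0 160 (160 + 2 * m.+1)) => n nm.
    (* Large enough for rho >= 2000000 and for the integer part K of rho / 16 to be at least n. *)
    have [r rA Hr] := H (32 * 1000 * (16 * n%:R + 2 * 1000 * 1000)).
    pose rho := r / (32 * 1000).
    have rhoA : 16 * n%:R + 2 * 1000 * 1000 <= rho.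
      by rewrite /rho ler_pdivlMr; [rewrite mulrC|clear; lra].
    have n0 : (0 : R) <= n%:R by [].
    have [rho_ge rhon] : 2 * 1000 * 1000 <= rho /\ n%:R <= rho / 16.
      by move: rhoA n0; clear; move: rho (n%:R : R) => y x; lra.
    have rho160 : 0 <= rho / 16 by apply: le_trans rhon.
    pose K := Num.truncn (rho / 16).
    have /andP[K1 K2] := truncn_itv rho160; rewrite -/K in K1 K2; clearbody K.
    have nK : (n <= K)%N.
      by rewrite -ltnS -(ltr_nat R); apply: le_lt_trans rhon K2.
    rewrite add0r; apply: le_trans (_ : 160 / K%:R <= _).
      apply: (geometric_of_few_zeros om1 rho_ge _ _ _ _ Hr).
      - by move: K1; rewrite -/rho; clear; move: rho (K%:R : R) => y x; lra.
      - by move: K2; rewrite -/rho; clear; move: rho (K.+1%:R : R) => y x; lra.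
      - by move: nm nK; clear; lia.
      - by move: nm nK; clear; lia.
    have n_gt0 : (0 < n)%N by apply: leq_ltn_trans nm.
    rewrite ler_wpM2l // lef_pV2 ?posrE ?ltr0n ?ler_nat //.
    exact: leq_trans n_gt0 nK.
  have /eqP : cabs (om m.+2 * om m / om m.+1 ^+ 2 - 1) == 0 by rewrite eq_le H0 cabs_ge0.
  move/eqP; rewrite cabs_eq0 subr_eq0 => /eqP E.
  by rewrite -[LHS](divfK (expf_neq0 2 (om0 m.+1))) E mul1r.
elim/ltn_ind => -[|[|n]] IH.
- by rewrite expr0 mulr1.
- by rewrite expr1 mulrC divfK.
have n2 : (n < n.+2)%N by rewrite ltnS leqnSn.
have := geo n; rewrite (IH n.+1 (ltnSn _)) (IH n n2) => E.
apply: (mulIf (om0 n)); rewrite (IH n n2) E.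
by rewrite !exprS; field; rewrite !om0.
Qed.

End Unimodular.

Theorem theorem1 (R : realType) :
  exists2 c : R, 0 < c &
    forall omega : nat -> Cplx R,
      (forall n : nat, `|omega n| = 1) ->
      let F := exp_series omega in
      (exists Theta alpha : Cplx R,
         [/\ `|Theta| = 1, `|alpha| = 1 &
           forall z : Cplx R, F z = Theta * cexp (alpha * z)])
      \/
      (c%:E <= limf_einf (fun r : R => zero_count F r * (r^-1)%:E) +oo%R)%E.
Proof.
exists (zero_density R); first exact: zero_density_gt0.
move=> omega om1 F.
have om1' n : cabs (omega n) = 1 by have := congr1 (@complex.Re R) (om1 n); rewrite normE.
have FE : F = pser (egf omega).
  apply/funext => z; rewrite /F /exp_series /pser.
  by congr (limn (series _)); apply/funext => n; rewrite /egf /= mulrCA mulrC.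
case: (leP (zero_density R)%:E
  (limf_einf (fun r : R => zero_count F r * (r^-1)%:E)%E +oo%R)) => [|Hlt]; first by right.
left.
have Hfew (A : R) : exists2 r, A <= r &
    (zero_count (pser (egf omega) : Cplx R -> Cplx R) r < (zero_density R * r)%:E)%E.
  (* The lower limit is a supremum of infima over neighbourhoods of +oo, so the infimum over this
     half-line is below the density; starting at 1 or later makes r positive, so that the division
     by r can be undone. *)
  pose V := [set r : R | Num.max A 1 <= r].
  have : (ereal_inf ((fun r : R => zero_count F r * (r^-1)%:E) @` V) < (zero_density R)%:E)%E.
    apply: le_lt_trans Hlt; rewrite limf_einfE; apply: ereal_sup_ubound.
    exists V => //; apply: nbhs_pinfty_ge; apply: num_real.
  move=> /ereal_inf_lt[_ [r /= + <-]]; rewrite /V /= ge_max => /andP[Ar r1].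
  by rewrite lte_pdivrMr ?(lt_le_trans ltr01 r1) // FE => H; exists r.
have om_geo := exponential_of_frequently_few_zeros om1' Hfew.
exists (omega 0%N), (omega 1%N / omega 0%N); split => //.
  by rewrite normrM normfV !om1 invr1 mulr1.
move=> z; set al := omega 1%N / omega 0%N in om_geo *.
pose e n : R[i] := n`!%:R^-1.
have eE : entire_coef e.
  have one (n : nat) : cabs ((fun=> 1 : R[i]) n) = 1 by rewrite cabs1.
  by have := entire_egf one; congr entire_coef; apply/funext => n; rewrite /egf mul1r.
have cexpE w : cexp w = pser e w.
  rewrite /cexp /pser; congr (limn (series _)); apply/funext => n /=.
  by rewrite /e mulrC.
rewrite FE cexpE; apply: pserE.
have H := cvgM (cvg_cst (omega 0%N : Cplx R)) (@cvg_pser R e (al * z) eE).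
rewrite (_ : series _ = (fun N => omega 0%N * series (fun n => e n * (al * z) ^+ n : Cplx R) N)).
  exact: H.
apply/funext => N; rewrite /series /= mulr_sumr; apply: eq_bigr => n _.
by rewrite /egf om_geo /e [(al * z) ^+ n]exprMn -!mulrA; congr (_ * _); rewrite mulrCA.
Qed.
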